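(* There are absolute constants (hidden in the $O(\cdot)$ and $\Omega(\cdot)$ below) such that the following holds. Let $\mathbf{A}\in\mathbb{R}^{n\times n}$ be symmetric, $\mathbf{x}\in\mathbb{R}^n$ nonzero, and $0<\epsilon\le 1$. Let $B=\log\left(\frac{\max(n,\|\mathbf{A}\|)}{\epsilon}\right)$. If the Lanczos algorithm (see context) is run on $\mathbf{A}$ and $\mathbf{x}$ with $f(x)=\exp(x)$ for $k=O(\|\mathbf{A}\|+\log(1/\epsilon))$ iterations on a computer satisfying Requirements 1 and 2 (see context) for precision $\epsilon_{mach}=2^{-\Omega(B)}$ (e.g. a computer using $\Omega(B)$ bits of precision), it outputs $\mathbf{y}$ satisfying $$\|\exp(\mathbf{A})\mathbf{x}-\mathbf{y}\|\le\epsilon C\|\mathbf{x}\|,\qquad\text{where } C=e^{2\|\mathbf{A}\|}.$$ The total runtime is $O(\mathrm{mv}(\mathbf{A})k+k^2B+kB^2)$, where $\mathrm{mv}(\mathbf{A})$ is the time required to multiply $\mathbf{A}$ by a vector to the precision required by Requirement 2.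
   Context: $\|\cdot\|$ is the Euclidean norm for vectors and the spectral norm for matrices; $f(\mathbf{M})=\mathbf{V}f(\mathbf{\Lambda})\mathbf{V}^T$ for symmetric $\mathbf{M}=\mathbf{V}\mathbf{\Lambda}\mathbf{V}^T$. Floating-point model. $\mathrm{fl}(\cdot)$ denotes the computed result. Requirement 1: for $\circ\in\{+,-,\times,\div\}$, $\mathrm{fl}(x\circ y)=(1+\delta)(x\circ y)$ and $\mathrm{fl}(\sqrt{x})=(1+\delta)\sqrt{x}$ with $|\delta|\le\epsilon_{mach}$. Requirement 2: for every $\mathbf{w}\in\mathbb{R}^n$, $\|\mathrm{fl}(\mathbf{A}\mathbf{w})-\mathbf{A}\mathbf{w}\|\le 2n^{3/2}\|\mathbf{A}\|\|\mathbf{w}\|\epsilon_{mach}$. Overflow and underflow are ignored. Runtimes are in the unit-cost RAM model, the scalar function $f$ can be evaluated to relative error $\epsilon_{mach}$ in $O(1)$ time, and $\mathrm{mv}(\mathbf{A})=\Omega(n)$. Lanczos algorithm (input symmetric $\mathbf{A}$, number of iterations $k$, vector $\mathbf{x}$, function $f$): set $\mathbf{q}_0=\mathbf{0}$, $\mathbf{q}_1=\mathbf{x}/\|\mathbf{x}\|$, $\beta_1=0$. For $i=1,\dots,k$: $\mathbf{q}_{i+1}\leftarrow\mathbf{A}\mathbf{q}_i-\beta_i\mathbf{q}_{i-1}$; $\alpha_i\leftarrow\langle\mathbf{q}_{i+1},\mathbf{q}_i\rangle$; $\mathbf{q}_{i+1}\leftarrow\mathbf{q}_{i+1}-\alpha_i\mathbf{q}_i$;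 $\beta_{i+1}\leftarrow\|\mathbf{q}_{i+1}\|$; if $\beta_{i+1}=0$ exit the loop; $\mathbf{q}_{i+1}\leftarrow\mathbf{q}_{i+1}/\beta_{i+1}$. Let $\mathbf{T}$ be the symmetric tridiagonal matrix with diagonal $\alpha_1,\dots,\alpha_k$ and off-diagonal $\beta_2,\dots,\beta_k$, and $\mathbf{Q}=[\mathbf{q}_1,\dots,\mathbf{q}_k]$ (if the loop exits early at iteration $i$, use the first $i$ coefficients and vectors). Return $\mathbf{y}=\|\mathbf{x}\|\cdot\mathbf{Q}f(\mathbf{T})\mathbf{e}_1$. The final step is carried out in floating point using the Gu–Eisenstat tridiagonal eigendecomposition: for $ck^3\log k\cdot\epsilon_{mach}\le\epsilon_1\le 1/2$ ($c$ a fixed constant) it computes in $O(k^2\log\frac{k}{\epsilon_1}+k\log^2\frac{k}{\epsilon_1})$ time matrices $\tilde{\mathbf{V}}$ and diagonal $\tilde{\mathbf{\Lambda}}$ with $\|\tilde{\mathbf{V}}\tilde{\mathbf{\Lambda}}\tilde{\mathbf{V}}^T-\mathbf{T}\|\le\epsilon_1\|\mathbf{T}\|$ and $\|\tilde{\mathbf{V}}^T\tilde{\mathbf{V}}-\mathbf{I}\|\le\epsilon_1$; it is called with $\epsilon_1=2^{-\Theta(B)}$ for a suitable hidden constant, and $f(\mathbf{T})\mathbf{e}_1$ is computed as $\tilde{\mathbf{V}}f(\tilde{\mathbf{\Lambda}})\tilde{\mathbf{V}}^T\mathbf{e}_1$. Asymptotic notation: $k$ and $\log(1/\epsilon_{mach})$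 are taken to be suitable (sufficiently large) absolute constants times the indicated expressions, where each expression inside $O(\cdot)$ or $\Omega(\cdot)$ is read as at least $1$. *)

(* Defs.v *)
From HB Require Import structures.
From mathcomp Require Import all_boot all_order all_algebra.
From mathcomp Require Import all_classical all_reals all_analysis.

Set Implicit Arguments.
Unset Strict Implicit.
Unset Printing Implicit Defensive.

Import Order.TTheory GRing.Theory Num.Theory.

Local Open Scope classical_set_scope.
Local Open Scope ring_scope.

(* The norm that MathComp-Analysis attaches to matrices is the max-entry norm,
   hence the following two definitions. *)
Definition enorm (R : realType) (n : nat) (v : 'cV[R]_n) : R :=
  Num.sqrt (\sum_(i < n) v i 0 ^+ 2).

Definition specnorm (R : realType) (m n : nat) (A : 'M[R]_(m, n)) : R :=
  sup [set enorm (A *m v) | v in [set v : 'cV[R]_n | enorm v <= 1]].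

(* [mxfun f A] is V f(L) V^T for a spectral decomposition A = V L V^T with V
   orthogonal; the result does not depend on the decomposition. When A has none
   (i.e. is not symmetric) the value is 0. *)
Definition is_mxfun (R : realType) (n : nat) (f : R -> R) (A F : 'M[R]_n) :
    Prop :=
  exists (V : 'M[R]_n) (d : 'rV[R]_n),
    [/\ V^T *m V = 1%:M,
        A = V *m diag_mx d *m V^T &
        F = V *m diag_mx (map_mx f d) *m V^T].

Definition mxfun (R : realType) (n : nat) (f : R -> R) (A : 'M[R]_n) : 'M[R]_n :=
  xget 0 (is_mxfun f A).

(* The computed results fl(.) of the primitives, each an arbitrary function, and
   the running times of those primitives that do not take unit time. [fl_eig T e]
   returns the factor V~ and the diagonal of L~ for target accuracy e. *)
Record machine (R : realType) := Machine {
  fl_add : R -> R -> R;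
  fl_sub : R -> R -> R;
  fl_mul : R -> R -> R;
  fl_div : R -> R -> R;
  fl_sqrt : R -> R;
  fl_fun : (R -> R) -> R -> R;
  time_fun : (R -> R) -> R -> nat;
  fl_mv : forall n : nat, 'M[R]_n -> 'cV[R]_n -> 'cV[R]_n;
  time_mv : forall n : nat, 'M[R]_n -> nat;
  fl_eig : forall m : nat, 'M[R]_m -> R -> 'M[R]_m * 'rV[R]_m;
  time_eig : forall m : nat, 'M[R]_m -> R -> nat }.

Definition rel_accurate (R : realType) (emach computed exact : R) : Prop :=
  exists delta : R, `|delta| <= emach /\ computed = (1 + delta) * exact.

Definition requirement1 (R : realType) (M : machine R) (emach : R) : Prop :=
  [/\ forall x y, rel_accurate emach (fl_add M x y) (x + y),
      forall x y, rel_accurate emach (fl_sub M x y) (x - y),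
      forall x y, rel_accurate emach (fl_mul M x y) (x * y),
      forall x y, y != 0 -> rel_accurate emach (fl_div M x y) (x / y) &
      forall x, 0 <= x -> rel_accurate emach (fl_sqrt M x) (Num.sqrt x)].

Definition requirement2 (R : realType) (M : machine R) (n : nat) (A : 'M[R]_n)
    (emach : R) : Prop :=
  forall w : 'cV[R]_n,
    enorm (fl_mv M A w - A *m w)
      <= 2 * n%:R `^ (3 / 2) * specnorm A * enorm w * emach.

Definition evaluates (R : realType) (M : machine R) (f : R -> R) (emach : R)
    (tf : nat) : Prop :=
  forall x, rel_accurate emach (fl_fun M f x) (f x) /\
            (time_fun M f x <= tf)%N.

Definition symtridiag (R : realType) (m : nat) (T : 'M[R]_m) : Prop :=
  T^T = T /\ forall i j : 'I_m, (i.+1 < j)%N -> T i j = 0.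

(* Guarantee of the Gu-Eisenstat algorithm; [c] is the constant of the accuracy
   range and [ct] the constant of the running time. *)
Definition gu_eisenstat (R : realType) (M : machine R) (emach c ct : R) : Prop :=
  forall (m : nat) (T : 'M[R]_m) (eps1 : R),
    (0 < m)%N -> symtridiag T ->
    c * m%:R ^+ 3 * ln m%:R * emach <= eps1 -> 0 < eps1 -> eps1 <= 1 / 2 ->
    let V := (fl_eig M T eps1).1 in
    let L := diag_mx (fl_eig M T eps1).2 in
    [/\ specnorm (V *m L *m V^T - T) <= eps1 * specnorm T,
        specnorm (V^T *m V - 1%:M) <= eps1 &
        (time_eig M T eps1)%:R
          <= ct * (m%:R ^+ 2 * ln (m%:R / eps1) + m%:R * ln (m%:R / eps1) ^+ 2)].

(* A computation is a pair (result, running time). *)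
Definition timed (T : Type) : Type := (T * nat)%type.

Definition tret (T : Type) (a : T) : timed T := (a, 0%N).

Definition tbind (T U : Type) (m : timed T) (F : T -> timed U) : timed U :=
  ((F m.1).1, (m.2 + (F m.1).2)%N).

Notation "'let*' x := m 'in' b" := (tbind m (fun x => b))
  (at level 200, x name, m at level 100, b at level 200,
   format "'[v' 'let*'  x  :=  m  'in' '/' b ']'").

(* Both loops charge, besides their body, one unit per iteration for control and
   storage. *)
Definition tfold (I S : Type) (F : S -> I -> timed S) (s0 : S) (r : seq I) :
    timed S :=
  foldl (fun c i => let* s := c in ((F s i).1, (F s i).2.+1)) (tret s0) r.

Definition tcol (R : realType) (n : nat) (F : 'I_n -> timed R) :
    timed 'cV[R]_n :=
  (\col_i (F i).1, (\sum_(i < n) (F i).2.+1)%N).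

Section Algorithm.
Variables (R : realType) (M : machine R).

Definition tadd (x y : R) : timed R := (fl_add M x y, 1%N).
Definition tsub (x y : R) : timed R := (fl_sub M x y, 1%N).
Definition tmul (x y : R) : timed R := (fl_mul M x y, 1%N).
Definition tdiv (x y : R) : timed R := (fl_div M x y, 1%N).
Definition tsqrt (x : R) : timed R := (fl_sqrt M x, 1%N).
Definition tis0 (x : R) : timed bool := (x == 0, 1%N).
Definition tfun (f : R -> R) (x : R) : timed R := (fl_fun M f x, time_fun M f x).
Definition tmv (n : nat) (A : 'M[R]_n) (w : 'cV[R]_n) : timed 'cV[R]_n :=
  (fl_mv M A w, time_mv M A).
Definition teig (m : nat) (T : 'M[R]_m) (eps1 : R) :
    timed ('M[R]_m * 'rV[R]_m) :=
  (fl_eig M T eps1, time_eig M T eps1).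

Definition tdot (n : nat) (u v : 'cV[R]_n) : timed R :=
  tfold (fun s i => let* p := tmul (u i 0) (v i 0) in tadd s p) 0 (enum 'I_n).

Definition tnorm (n : nat) (u : 'cV[R]_n) : timed R :=
  let* s := tdot u u in tsqrt s.

Definition tsubscale (n : nat) (u : 'cV[R]_n) (a : R) (v : 'cV[R]_n) :
    timed 'cV[R]_n :=
  tcol (fun i => let* p := tmul a (v i 0) in tsub (u i 0) p).

Definition tscale (n : nat) (a : R) (u : 'cV[R]_n) : timed 'cV[R]_n :=
  tcol (fun i => tmul a (u i 0)).

Definition tdivscale (n : nat) (u : 'cV[R]_n) (a : R) : timed 'cV[R]_n :=
  tcol (fun i => tdiv (u i 0) a).

(* Dense product with the entries of P, as opposed to [tmv]. *)
Definition tmulmx (p m : nat) (P : 'M[R]_(p, m)) (u : 'cV[R]_m) :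
    timed 'cV[R]_p :=
  tcol (fun i => tdot (row i P)^T u).

(* Runs at most [k] iterations from (q_{i-1}, q_i, beta_i) and returns the
   triples (alpha_i, beta_{i+1}, q_i) of the iterations performed, including the
   one at which beta_{i+1} = 0. *)
Fixpoint lanczos_loop (n : nat) (A : 'M[R]_n) (k : nat) (qprev q : 'cV[R]_n)
    (beta : R) {struct k} : timed (seq (R * R * 'cV[R]_n)) :=
  if k is k'.+1 then
    let* w0 := tmv A q in
    let* w1 := tsubscale w0 beta qprev in
    let* alpha := tdot w1 q in
    let* w2 := tsubscale w1 alpha q in
    let* beta' := tnorm w2 in
    let* stop := tis0 beta' in
    if stop then tret [:: (alpha, beta', q)]
    else
      let* q' := tdivscale w2 beta' in
      let* s := lanczos_loop A k' q q' beta' in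
      tret ((alpha, beta', q) :: s)
  else tret [::].

Definition lanczos_T (n : nat) (s : seq (R * R * 'cV[R]_n)) : 'M[R]_(size s) :=
  let alpha i := (nth (0, 0, 0) s i).1.1 in
  let beta i := (nth (0, 0, 0) s i).1.2 in
  \matrix_(i, j)
    if i == j then alpha i
    else if (j == i.+1 :> nat) then beta i
    else if (i == j.+1 :> nat) then beta j
    else 0.

Definition lanczos_Q (n : nat) (s : seq (R * R * 'cV[R]_n)) :
    'M[R]_(n, size s) :=
  \matrix_(i, j) (nth (0, 0, 0) s j).2 i 0.

(* V~ f(L~) V~^T e_1, evaluated from right to left *)
Definition tmxfun_e1 (f : R -> R) (m : nat) (T : 'M[R]_m) (eps1 : R) :
    timed 'cV[R]_m :=
  let* VL := teig T eps1 in
  let* u := tmulmx VL.1^T (\col_i (i == 0%N :> nat)%:R) in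
  let* v := tcol (fun i => let* fl := tfun f (VL.2 0 i) in tmul fl (u i 0)) in
  tmulmx VL.1 v.

Definition lanczos (n : nat) (A : 'M[R]_n) (k : nat) (x : 'cV[R]_n)
    (f : R -> R) (eps1 : R) : timed 'cV[R]_n :=
  let* nx := tnorm x in
  let* q1 := tdivscale x nx in
  let* s := lanczos_loop A k 0 q1 0 in
  let* z := tmxfun_e1 f (lanczos_T s) eps1 in
  let* y := tmulmx (lanczos_Q s) z in
  tscale nx y.

End Algorithm.

(* Main.v *)
(* Write [a] for the spectral norm of A. Computed Lanczos vectors lose orthogonality, but the
   three-term recurrence holds up to small residuals, and so do local relations between
   consecutive vectors. Symmetry of A turns them into
   alpha_i^2 + beta_i^2 + beta_(i+1)^2 <= 1.08 a^2, so that the tridiagonal matrix T satisfies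
   ||T|| <= sqrt 3 * sqrt 1.08 * a = 1.8 a < 2 a. This simple bound replaces Paige's theorem on
   the eigenvalues of T, at the price of the constant e^(2a).
   If A Q = Q T + E then A^j Q e_1 - Q T^j e_1 is a sum of terms A^(j-1-i) E T^i e_1. Summing over
   the exponential series, the rounding part of E costs a factor e^(2a), while its part supported
   on the last column is only seen by T^i e_1 with i >= k - 1, where the tail of the series is tiny
   because k exceeds a large multiple of a + log(1/eps). The same intertwining argument, applied
   to T V = V L + F, controls the approximate eigendecomposition. *)
Require Import Defs.
From HB Require Import structures.
From mathcomp Require Import all_boot all_order all_algebra.
From mathcomp Require Import all_classical all_reals all_analysis.
From mathcomp Require Import ring lra zify.
From mathcomp Require Import complex spectral.
Set Implicit Arguments.
Unset Strict Implicit.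
Unset Printing Implicit Defensive.
Import Order.TTheory GRing.Theory Num.Theory numFieldNormedType.Exports.
Local Open Scope classical_set_scope.
Local Open Scope ring_scope.

(** Everything is compared with truncated Taylor series of one common degree [D], which is fixed
    only after [k] and is unrelated to it. The exponential of T therefore never occurs, and exp(A)
    is met in its eigenbasis only, where the comparison is scalar. The single number tau = 2 a
    bounds ||A||, ||T|| and, because 10/9 * 9/5 = 2, also the computed eigenvalues; so all errors
    are multiples of the same factor e^(2 a). The obstacle is the lack of global orthogonality. The
    invariant of the loop speaks of two neighbouring vectors only, and their orthogonality enters
    multiplied by beta, because division by a tiny beta may magnify errors without bound. Only one
    of its bounds deteriorates, the defect of beta_i <q_i, A q_(i-1)> = beta_i^2, and it grows by a
    fixed multiple of h a^2 per iteration. The drift is thus linear in the number of iterations, and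
    a precision polynomial in [k] suffices. For the same reason ||Q|| is bounded through its
    Frobenius norm, at most 2 k, which costs one more polynomial factor. *)

Section EuclideanNorm.
Variable R : realType.
Implicit Types (m n p : nat) (c : R).

Definition dotv n (u v : 'cV[R]_n) : R := \sum_i u i 0 * v i 0.

Lemma dotvC n (u v : 'cV[R]_n) : dotv u v = dotv v u.
Proof. by apply: eq_bigr => i _; rewrite mulrC. Qed.

Lemma dotvDl n (u v w : 'cV[R]_n) : dotv (u + v) w = dotv u w + dotv v w.
Proof. by rewrite /dotv -big_split; apply: eq_bigr => i _ /=; rewrite mxE mulrDl. Qed.

Lemma dotvZl n c (u v : 'cV[R]_n) : dotv (c *: u) v = c * dotv u v.
Proof. by rewrite /dotv mulr_sumr; apply: eq_bigr => i _; rewrite mxE mulrA. Qed.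

Lemma dotvNl n (u v : 'cV[R]_n) : dotv (- u) v = - dotv u v.
Proof. by rewrite -scaleN1r dotvZl mulN1r. Qed.

Lemma dotvBl n (u v w : 'cV[R]_n) : dotv (u - v) w = dotv u w - dotv v w.
Proof. by rewrite dotvDl dotvNl. Qed.

Lemma dotvDr n (u v w : 'cV[R]_n) : dotv w (u + v) = dotv w u + dotv w v.
Proof. by rewrite dotvC dotvDl !(dotvC w). Qed.

Lemma dotvZr n c (u v : 'cV[R]_n) : dotv u (c *: v) = c * dotv u v.
Proof. by rewrite dotvC dotvZl dotvC. Qed.

Lemma dotvBr n (u v w : 'cV[R]_n) : dotv w (u - v) = dotv w u - dotv w v.
Proof. by rewrite dotvC dotvBl !(dotvC w). Qed.

Lemma dotv0l n (u : 'cV[R]_n) : dotv 0 u = 0.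
Proof. by rewrite /dotv big1 // => i _; rewrite mxE mul0r. Qed.

Lemma dotv0r n (u : 'cV[R]_n) : dotv u 0 = 0.
Proof. by rewrite dotvC dotv0l. Qed.

Lemma dotvE n (u v : 'cV[R]_n) : u^T *m v = (dotv u v)%:M.
Proof.
by apply/matrixP => i j; rewrite !ord1 !mxE eqxx mulr1n; apply: eq_bigr => k _; rewrite mxE.
Qed.

Lemma dotv_mulmxl m n (A : 'M[R]_(m, n)) (u : 'cV[R]_n) (v : 'cV[R]_m) :
  dotv (A *m u) v = dotv u (A^T *m v).
Proof.
have /matrixP/(_ 0 0) : (A *m u)^T *m v = u^T *m (A^T *m v) by rewrite trmx_mul mulmxA.
by rewrite !dotvE !mxE eqxx !mulr1n.
Qed.

Lemma dotvv_ge0 n (u : 'cV[R]_n) : 0 <= dotv u u.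
Proof. by apply: sumr_ge0 => i _; rewrite -expr2 sqr_ge0. Qed.

Lemma enorm_sqr n (u : 'cV[R]_n) : enorm u ^+ 2 = dotv u u.
Proof.
rewrite /enorm sqr_sqrtr; last by apply: sumr_ge0 => i _; exact: sqr_ge0.
by apply: eq_bigr => i _; rewrite expr2.
Qed.

Lemma enorm_ge0 n (u : 'cV[R]_n) : 0 <= enorm u.
Proof. exact: sqrtr_ge0. Qed.

Lemma enorm_le_sqr n (u : 'cV[R]_n) c : 0 <= c -> dotv u u <= c ^+ 2 -> enorm u <= c.
Proof. by move=> c0; rewrite -enorm_sqr ler_sqr ?nnegrE ?enorm_ge0. Qed.

Lemma enorm0 n : enorm (0 : 'cV[R]_n) = 0.
Proof. by apply/eqP; rewrite -sqrf_eq0 enorm_sqr dotv0l. Qed.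

Lemma enorm_eq0 n (u : 'cV[R]_n) : (enorm u == 0) = (u == 0).
Proof.
apply/idP/eqP => [|->]; last by rewrite enorm0.
rewrite -sqrf_eq0 enorm_sqr psumr_eq0; last by move=> i _; rewrite -expr2 sqr_ge0.
move=> /allP h; apply/matrixP => i j; rewrite ord1 mxE.
by have := h i (mem_index_enum _); rewrite -expr2 sqrf_eq0 => /eqP.
Qed.

Lemma enorm_gt0 n (u : 'cV[R]_n) : (0 < enorm u) = (u != 0).
Proof. by rewrite lt0r enorm_eq0 enorm_ge0 andbT. Qed.

Lemma enormZ n c (u : 'cV[R]_n) : enorm (c *: u) = `|c| * enorm u.
Proof.
apply/eqP; rewrite -(eqrXn2 (n := 2)) ?enorm_ge0 ?mulr_ge0 ?enorm_ge0 //.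
by rewrite exprMn !enorm_sqr dotvZl dotvZr real_normK ?num_real// expr2 mulrA.
Qed.

Lemma enormN n (u : 'cV[R]_n) : enorm (- u) = enorm u.
Proof. by rewrite -scaleN1r enormZ normrN1 mul1r. Qed.

Lemma enormBC n (u v : 'cV[R]_n) : enorm (u - v) = enorm (v - u).
Proof. by rewrite -enormN opprB. Qed.

Lemma cauchy_schwarz_sqr n (u v : 'cV[R]_n) : dotv u v ^+ 2 <= dotv u u * dotv v v.
Proof.
have [->|v0] := eqVneq v 0; first by rewrite !dotv0r expr0n mulr0.
have vv : 0 < dotv v v by rewrite -enorm_sqr exprn_gt0 ?enorm_gt0.
rewrite -subr_ge0 -(pmulr_rge0 _ vv).
have := dotvv_ge0 (dotv v v *: u - dotv u v *: v).
rewrite !(dotvBl, dotvBr, dotvZl, dotvZr) (dotvC v u); lra.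
Qed.

Lemma cauchy_schwarz n (u v : 'cV[R]_n) : `|dotv u v| <= enorm u * enorm v.
Proof.
rewrite -(ler_sqr (R := R)) ?nnegrE ?mulr_ge0 ?enorm_ge0//.
by rewrite real_normK ?num_real// exprMn !enorm_sqr cauchy_schwarz_sqr.
Qed.

Lemma ler_enormD n (u v : 'cV[R]_n) : enorm (u + v) <= enorm u + enorm v.
Proof.
apply: enorm_le_sqr; first by rewrite addr_ge0 ?enorm_ge0.
rewrite !(dotvDl, dotvDr) -!enorm_sqr (dotvC v u).
have := cauchy_schwarz u v; have := ler_norm (dotv u v); rewrite sqrrD; lra.
Qed.

Lemma ler_enormB n (u v : 'cV[R]_n) : enorm (u - v) <= enorm u + enorm v.
Proof. by rewrite -[enorm v]enormN ler_enormD. Qed.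

Lemma ler_enorm_dist n (u v : 'cV[R]_n) : enorm u <= enorm (u - v) + enorm v.
Proof. by have := ler_enormD (u - v) v; rewrite subrK. Qed.

Lemma ler_enorm_sum n (I : finType) (P : pred I) (F : I -> 'cV[R]_n) :
  enorm (\sum_(i | P i) F i) <= \sum_(i | P i) enorm (F i).
Proof.
elim/big_rec2: _ => [|i x y _ h]; first by rewrite enorm0.
by rewrite (le_trans (ler_enormD _ _))// lerD2l.
Qed.

Lemma ler_enorm_coord n (u v : 'cV[R]_n) :
  (forall i, `|u i 0| <= `|v i 0|) -> enorm u <= enorm v.
Proof.
move=> h; apply: enorm_le_sqr; rewrite ?enorm_ge0// enorm_sqr.
by apply: ler_sum => i _; rewrite -!expr2 -(real_normK (num_real (u i 0))) -(real_normK (num_real (v i 0))) ler_sqr ?nnegrE.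
Qed.

Lemma enorm_abs n (u : 'cV[R]_n) : enorm (\col_i `|u i 0|) = enorm u.
Proof. by apply/eqP; rewrite eq_le; apply/andP; split; apply: ler_enorm_coord => i; rewrite mxE normr_id. Qed.

(** Comparison with the vectors of absolute values turns entrywise rounding bounds into norm bounds
    without a factor depending on the dimension. With [d = 0] it also serves for bounds by a single
    vector. *)
Lemma ler_enorm_coord2 n (w u v : 'cV[R]_n) c d : 0 <= c -> 0 <= d ->
  (forall i, `|w i 0| <= c * `|u i 0| + d * `|v i 0|) ->
  enorm w <= c * enorm u + d * enorm v.
Proof.
move=> c0 d0 h.
have: enorm w <= enorm (c *: (\col_i `|u i 0|) + d *: (\col_i `|v i 0|)).
  apply: ler_enorm_coord => i; rewrite !mxE (le_trans (h i)) //.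
  by apply: ler_norm.
move=> /le_trans; apply; rewrite (le_trans (ler_enormD _ _)) //.
by rewrite !enormZ !enorm_abs !ger0_norm.
Qed.

Lemma ler_coord_enorm n (u : 'cV[R]_n) i : `|u i 0| <= enorm u.
Proof.
rewrite -(ler_sqr (R := R)) ?nnegrE ?enorm_ge0// real_normK ?num_real// enorm_sqr.
rewrite /dotv (bigD1 i)//= -expr2 lerDl; apply: sumr_ge0 => j _.
by rewrite -expr2 sqr_ge0.
Qed.

Lemma enorm_delta n (i : 'I_n) : enorm (delta_mx i 0 : 'cV[R]_n) = 1.
Proof.
apply/eqP; rewrite -(eqrXn2 (n := 2)) ?enorm_ge0// enorm_sqr expr1n /dotv.
rewrite (bigD1 i)//= !mxE !eqxx mulr1 big1 ?addr0// => j ji.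
by rewrite !mxE (negPf ji) mul0r.
Qed.

Lemma sum_abs_le_enorm n (u : 'cV[R]_n) : \sum_i `|u i 0| <= n%:R * enorm u.
Proof.
have: \sum_i `|u i 0| <= \sum_(i < n) enorm u.
  by apply: ler_sum => i _; exact: ler_coord_enorm.
by rewrite sumr_const card_ord mulr_natl.
Qed.

Lemma row_dotv m n (A : 'M[R]_(m, n)) (v : 'cV[R]_n) i :
  (A *m v) i 0 = dotv (row i A)^T v.
Proof. by rewrite !mxE; apply: eq_bigr => j _; rewrite !mxE. Qed.

Lemma enorm_mulmx_frob m n (A : 'M[R]_(m, n)) (v : 'cV[R]_n) :
  enorm (A *m v) <= Num.sqrt (\sum_i \sum_j A i j ^+ 2) * enorm v.
Proof.
have S0 : 0 <= \sum_i \sum_j A i j ^+ 2.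
  by apply: sumr_ge0 => i _; apply: sumr_ge0 => j _; exact: sqr_ge0.
apply: enorm_le_sqr; first by rewrite mulr_ge0 ?sqrtr_ge0 ?enorm_ge0.
rewrite exprMn sqr_sqrtr// enorm_sqr mulr_suml; apply: ler_sum => i _.
rewrite -expr2 row_dotv (le_trans (cauchy_schwarz_sqr _ _))// ler_wpM2r ?dotvv_ge0//.
by rewrite le_eqVlt /dotv; apply/orP; left; apply/eqP; apply: eq_bigr => j _; rewrite !mxE expr2.
Qed.

(** [sup] is a true supremum only on a nonempty set with an upper bound; the Frobenius norm supplies
    the bound. *)
Lemma specnorm_ub m n (A : 'M[R]_(m, n)) :
  has_sup [set enorm (A *m v) | v in [set v : 'cV[R]_n | enorm v <= 1]].
Proof.
split; first by exists 0, 0; rewrite /= ?enorm0 ?ler01 // mulmx0 enorm0.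
exists (Num.sqrt (\sum_i \sum_j A i j ^+ 2)) => _ [v /= v1 <-].
rewrite (le_trans (enorm_mulmx_frob _ _))// -[leRHS]mulr1.
by rewrite ler_wpM2l ?sqrtr_ge0.
Qed.

Lemma specnorm_ge0 m n (A : 'M[R]_(m, n)) : 0 <= specnorm A.
Proof.
have [_ h] := specnorm_ub A.
by apply: (ub_le_sup h); exists 0; rewrite /= ?enorm0 ?ler01// mulmx0 enorm0.
Qed.

Lemma enorm_mulmx m n (A : 'M[R]_(m, n)) (v : 'cV[R]_n) :
  enorm (A *m v) <= specnorm A * enorm v.
Proof.
have [->|v0] := eqVneq v 0; first by rewrite mulmx0 !enorm0 mulr0.
have vp : 0 < enorm v by rewrite enorm_gt0.
have [_ h] := specnorm_ub A.
rewrite -ler_pdivrMr//.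
apply: (le_trans (y := enorm (A *m ((enorm v)^-1 *: v)))).
  by rewrite -scalemxAr enormZ gtr0_norm ?invr_gt0// mulrC.
apply: (ub_le_sup h); exists ((enorm v)^-1 *: v) => //=.
by rewrite enormZ gtr0_norm ?invr_gt0// mulVf ?gt_eqF.
Qed.

Lemma specnorm_le m n (A : 'M[R]_(m, n)) c : 0 <= c ->
  (forall v, enorm (A *m v) <= c * enorm v) -> specnorm A <= c.
Proof.
move=> c0 h; apply: ge_sup; first by have [] := specnorm_ub A.
by move=> _ [v /= v1 <-]; rewrite (le_trans (h v))// -[leRHS]mulr1 ler_wpM2l.
Qed.

End EuclideanNorm.

(** * Spectral theorem for real symmetric matrices *)

Section SpectralTheorem.
Variable R : realType.

(** Over the complex numbers the matrix is Hermitian, so it has an eigenvalue and this one is real.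
    Being an eigenvalue does not depend on the field, which gives a real eigenvector. [eigenvalue]
    refers to row vectors; symmetry allows the transposition. *)
Lemma symmetric_eigenvector n (A : 'M[R]_n) : (0 < n)%N -> A^T = A ->
  exists2 v : 'cV[R]_n, enorm v = 1 & exists d, A *m v = d *: v.
Proof.
case: n A => // n A _ Asym.
pose f := real_complex R; pose AC := map_mx f A.
have ACh : AC \is hermsymmx.
  apply: realsym_hermsym.
    apply/is_hermitianmxP; rewrite expr0 scale1r; apply/matrixP => i j.
    by rewrite !mxE -[in LHS]Asym mxE.
  by apply/mxOverP => i j; rewrite mxE realE !lecR -realE num_real.
have ACe := ACh; move/hermitian_normalmx/orthomx_spectralP: ACe => ACe.
have dr := hermitian_spectral_diag_real ACh.
set P := spectralmx AC in ACe; set D := spectral_diag AC in ACe dr.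
have Pu : P \in unitmx by exact: spectral_unit.
have PA : P *m AC = diag_mx D *m P by rewrite {1}ACe !mulmxA mulmxV// mul1mx.
have d0r : D 0 0 \is Num.real by exact: (mxOverP dr).
have d0E : D 0 0 = f (complex.Re (D 0 0)) by apply: esym; apply: RRe_real.
set d := complex.Re _ in d0E.
have : eigenvalue A d.
  have <- := eigenvalue_map f A d.
  apply/eigenvalueP; exists (row 0 P).
    rewrite -row_mul PA; apply/rowP => j; rewrite mxE mul_diag_mx !mxE.
    by rewrite d0E.
  apply/eqP => P0; have := mulmxV Pu => /(congr1 (row 0)).
  rewrite row_mul P0 mul0mx => /rowP/(_ 0)/eqP; rewrite !mxE eqxx.
  by rewrite eq_sym oner_eq0.
case/eigenvalueP => v vA v0.
have vp : 0 < enorm v^T by rewrite enorm_gt0 trmx_eq0.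
exists ((enorm v^T)^-1 *: v^T).
  by rewrite enormZ gtr0_norm ?invr_gt0// mulVf ?gt_eqF.
exists d; rewrite -scalemxAr scalerA mulrC -scalerA; congr (_ *: _).
by rewrite -{1}Asym -trmx_mul vA linearZ.
Qed.

(* Householder reflection exchanging [v] and the first basis vector. *)
Lemma orthogonal_extension n (v : 'cV[R]_n.+1) : enorm v = 1 ->
  exists H : 'M[R]_n.+1, [/\ H^T = H, H *m H = 1%:M & H *m delta_mx 0 0 = v].
Proof.
move=> v1; pose e : 'cV[R]_n.+1 := delta_mx 0 0.
have [->|vNe] := eqVneq v e.
  by exists 1%:M; rewrite trmx1 !mul1mx.
pose w := v - e; pose s := dotv w w.
have s0 : s != 0 by rewrite /s -enorm_sqr sqrf_eq0 enorm_eq0 subr_eq0.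
have ww : w^T *m w = s%:M by rewrite dotvE.
have [vv ee] : dotv v v = 1 /\ dotv e e = 1.
  by rewrite -!enorm_sqr v1 enorm_delta expr1n.
have we : w^T *m e = (- s / 2)%:M.
  by rewrite dotvE /s /w !(dotvBl, dotvBr) vv ee (dotvC e v); congr (_%:M); lra.
pose H : 'M[R]_n.+1 := 1%:M - (2 / s) *: (w *m w^T).
exists H; split.
- by rewrite /H linearB /= linearZ /= trmx1 trmx_mul trmxK.
- have MM : (w *m w^T) *m (w *m w^T) = s *: (w *m w^T).
    by rewrite -mulmxA (mulmxA w^T) ww mul_scalar_mx -scalemxAr.
  rewrite /H mulmxBl mul1mx -scalemxAl mulmxBr mulmx1 -scalemxAr MM scalerBr !scalerA.
  rewrite (_ : 2 / s * (2 / s) * s = 2 / s + 2 / s); last by field.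
  by rewrite scalerDl opprB addrK subrK.
- rewrite /H mulmxBl mul1mx -scalemxAl -mulmxA we mul_mx_scalar scalerA.
  by rewrite (_ : 2 / s * _ = -1) ?scaleN1r ?opprK ?/w 1?addrC ?subrK//; field.
Qed.

(** Deflation: conjugating by a reflection that sends the first basis vector to a unit eigenvector
    clears the first column, and by symmetry the first row, off the diagonal. Induction applies to
    the remaining block. *)
Lemma real_spectral n (A : 'M[R]_n) : A^T = A ->
  exists (V : 'M[R]_n) (d : 'rV[R]_n),
    V^T *m V = 1%:M /\ A = V *m diag_mx d *m V^T.
Proof.
elim: n A => [|n IH] A Asym.
  by exists 1%:M, 0; split; apply/matrixP => -[].
have [v v1 [d Av]] := symmetric_eigenvector (ltn0Sn n) Asym.
have [H [HT HH Hv]] := orthogonal_extension v1.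
have [B1 B1E] : exists B1 : 'M[R]_n.+1, B1 = H *m A *m H by eexists.
pose B : 'M[R]_(1 + n) := B1.
have BT : B^T = B by rewrite /B B1E !trmx_mul Asym HT mulmxA.
have Be : B1 *m (delta_mx 0 0 : 'cV_n.+1) = d *: delta_mx 0 0.
  by rewrite B1E -!mulmxA Hv Av -scalemxAr -Hv mulmxA HH mul1mx.
pose B' := drsubmx B.
have B'T : B'^T = B' by rewrite /B' trmx_drsub BT.
have B0 (i : 'I_n.+1) : B1 i 0 = d * (i == 0)%:R.
  have /matrixP/(_ i 0) := Be; rewrite -colE !mxE => ->.
  by rewrite andbT.
have l0 : (0 : 'I_n.+1) = lshift n (0 : 'I_1) by exact: val_inj.
have BB0 (i : 'I_(1 + n)) : B i (lshift n 0) = d * (i == lshift n 0)%:R.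
  by have := B0 i; rewrite l0.
have BE : B = block_mx d%:M 0 0 B'.
  rewrite -[LHS]submxK; congr block_mx; apply/matrixP => i j.
  - by rewrite !ord1 !mxE BB0 !eqxx mulr1n mulr1.
  - by rewrite !ord1 !mxE -BT mxE BB0 eq_rlshift mulr0.
  - by rewrite !ord1 !mxE BB0 eq_rlshift mulr0.
have [V [e [VV B'E]]] := IH _ B'T.
pose W : 'M[R]_(1 + n) := block_mx 1%:M 0 0 V.
pose D : 'rV[R]_(1 + n) := row_mx d%:M e.
have WW : W^T *m W = 1%:M.
  rewrite /W tr_block_mx !trmx0 trmx1 mulmx_block !mulmx0 !mul0mx !mulmx1 !addr0 !add0r VV.
  by rewrite -scalar_mx_block.
have WDW : W *m diag_mx D *m W^T = B.
  rewrite BE /W /D diag_mx_row tr_block_mx !trmx0 trmx1 !mulmx_block.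
  rewrite !(mulmx0, mul0mx, mulmx1, mul1mx, addr0, add0r) -B'E.
  by congr block_mx; apply/matrixP => i j; rewrite !ord1 !mxE eqxx.
exists (H *m (W : 'M[R]_n.+1)), D; split.
  by rewrite trmx_mul HT -mulmxA (mulmxA H) HH mul1mx.
have -> : A = H *m B1 *m H.
  by rewrite B1E -!mulmxA HH mulmx1 mulmxA HH mul1mx.
rewrite trmx_mul HT !mulmxA; congr (_ *m H); rewrite -!mulmxA; congr (H *m _).
by rewrite mulmxA; apply: esym; exact: WDW.
Qed.

(** The spectral theorem excludes the default value of [xget]. *)
Lemma mxfunP n (f : R -> R) (A : 'M[R]_n) : A^T = A -> is_mxfun f A (mxfun f A).
Proof.
move=> /real_spectral[V [d [VV AE]]].
by apply: (@xgetPex _ _ (is_mxfun f A)); exists (V *m diag_mx (map_mx f d) *m V^T), V, d.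
Qed.

End SpectralTheorem.

(** * Truncated exponential series and intertwining relations *)

Section Taylor.
Variable R : realType.
Implicit Types (m n D j : nat) (t tau : R).

Definition exp_poly D t : R := \sum_(j < D) t ^+ j / j`!%:R.

Lemma exp_polyE D t : exp_poly D t = series (exp_coeff t) D.
Proof. by rewrite /series /= big_mkord. Qed.

Lemma exp_poly_cvg t : exp_poly D t @[D --> \oo] --> expR t.
Proof.
rewrite (_ : (fun D => _) = series (exp_coeff t)); first exact: is_cvg_series_exp_coeff.
by apply/funext => D; rewrite exp_polyE.
Qed.

(** The terms between the two degrees at [t] are dominated by those at [tau], so that one tail,
    taken at [tau], later serves all eigenvalues at once. *)
Lemma exp_poly_diff D N t tau : `|t| <= tau -> (D <= N)%N ->
  `|exp_poly N t - exp_poly D t| <= exp_poly N tau - exp_poly D tau.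
Proof.
move=> tt DN; have t0 : 0 <= tau by rewrite (le_trans _ tt).
rewrite /exp_poly -!(big_mkord xpredT (fun j => _ ^+ j / j`!%:R)).
rewrite !(big_cat_nat (leq0n D) DN) //= !(addrC (\sum_(0 <= i < D) _)) !addrK.
rewrite (le_trans (ler_norm_sum _ _ _))//; apply: ler_sum => j _.
by rewrite normrM normrX normfV (@ger0_norm _ j`!%:R)// ler_wpM2r// lerXn2r// nnegrE.
Qed.

Lemma le_expR_near t c : (\forall N \near \oo, c <= exp_poly N t) -> c <= expR t.
Proof. exact: (cvgr_to_ge (@exp_poly_cvg t)). Qed.

Lemma expR_le_near t c : (\forall N \near \oo, exp_poly N t <= c) -> expR t <= c.
Proof. exact: (cvgr_to_le (@exp_poly_cvg t)). Qed.

Lemma exp_poly_le D t : 0 <= t -> exp_poly D t <= expR t.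
Proof.
move=> t0; apply: le_expR_near; near=> N.
have DN : (D <= N)%N by near: N; exact: nbhs_infty_ge.
have := @exp_poly_diff D N t t; rewrite ger0_norm// => /(_ (lexx _) DN).
by have := normr_ge0 (exp_poly N t - exp_poly D t); lra.
Unshelve. all: by end_near. Qed.

Lemma exp_tail D t tau : `|t| <= tau ->
  `|expR t - exp_poly D t| <= expR tau - exp_poly D tau.
Proof.
move=> tt; have t0 : 0 <= tau by rewrite (le_trans _ tt).
have h : \forall N \near \oo, exp_poly D t - (expR tau - exp_poly D tau) <= exp_poly N t
   <= exp_poly D t + (expR tau - exp_poly D tau).
  near=> N; have DN : (D <= N)%N by near: N; exact: nbhs_infty_ge.
  have := exp_poly_diff tt DN; have := exp_poly_le N t0; rewrite ler_norml; lra.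
rewrite ler_norml; apply/andP; split.
  suff : exp_poly D t - (expR tau - exp_poly D tau) <= expR t by lra.
  by apply: le_expR_near; apply: filterS h => N /andP[].
suff : expR t <= exp_poly D t + (expR tau - exp_poly D tau) by lra.
by apply: expR_le_near; apply: filterS h => N /andP[].
Unshelve. all: by end_near. Qed.

Lemma exp_tail_small tau eta : 0 < eta -> exists D, expR tau - exp_poly D tau <= eta.
Proof.
move=> e0; have /cvgr_ge/(_ (expR tau - eta)) := @exp_poly_cvg tau.
rewrite gtrBl => /(_ e0)[D _ /(_ D (leqnn D))] h; exists D; lra.
Qed.

(** Built from the vectors A^j v, for which the intertwining arguments are recurrences. *)
Definition taylor n D (A : 'M[R]_n) (v : 'cV[R]_n) : 'cV[R]_n :=
  \sum_(j < D) j`!%:R^-1 *: iter j (mulmx A) v.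

Lemma enorm_iter n (A : 'M[R]_n) tau v j : 0 <= tau ->
  (forall w, enorm (A *m w) <= tau * enorm w) ->
  enorm (iter j (mulmx A) v) <= tau ^+ j * enorm v.
Proof.
move=> t0 h; elim: j => [|j IH]; first by rewrite expr0 mul1r.
by rewrite iterS exprS -mulrA (le_trans (h _))// ler_wpM2l.
Qed.

Lemma fact_inv_ge0 j : 0 <= j`!%:R^-1 :> R. Proof. by rewrite invr_ge0. Qed.

Lemma enorm_taylor n D (A : 'M[R]_n) tau v : 0 <= tau ->
  (forall w, enorm (A *m w) <= tau * enorm w) ->
  enorm (taylor D A v) <= expR tau * enorm v.
Proof.
move=> t0 h; apply: (@le_trans _ _ (exp_poly D tau * enorm v)); last first.
  by rewrite ler_wpM2r ?enorm_ge0// exp_poly_le.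
rewrite (le_trans (ler_enorm_sum _ _))// mulr_suml; apply: ler_sum => j _.
rewrite enormZ ger0_norm ?fact_inv_ge0// mulrC -mulrA [_^-1 * _]mulrC mulrA.
by rewrite ler_wpM2r ?fact_inv_ge0// enorm_iter.
Qed.

Lemma taylorB n D (A : 'M[R]_n) u v : taylor D A (u - v) = taylor D A u - taylor D A v.
Proof.
rewrite /taylor -sumrB; apply: eq_bigr => j _; rewrite -scalerBr; congr (_ *: _).
by elim: (j : nat) => //= i ->; rewrite mulmxBr.
Qed.

Lemma taylorZ n D (A : 'M[R]_n) c v : taylor D A (c *: v) = c *: taylor D A v.
Proof.
rewrite /taylor scaler_sumr; apply: eq_bigr => j _; rewrite !scalerA mulrC -scalerA.
by congr (_ *: _); elim: (j : nat) => //= i ->; rewrite -scalemxAr.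
Qed.

Lemma taylor_diag n D (d : 'rV[R]_n) v i :
  taylor D (diag_mx d) v i 0 = exp_poly D (d 0 i) * v i 0.
Proof.
rewrite /taylor summxE mulr_suml; apply: eq_bigr => j _; rewrite mxE mulrC.
rewrite [RHS]mulrAC; congr (_ * _).
elim: (j : nat) => [|k IH]; first by rewrite expr0 mul1r.
by rewrite iterS mul_diag_mx mxE IH exprS mulrA.
Qed.

Section Intertwining.
Variables (n m : nat) (A : 'M[R]_n) (T : 'M[R]_m) (P : 'M[R]_(n, m)) (v : 'cV[R]_m).
Variables (tau kappa b : R) (K : nat).
Hypotheses (tau0 : 0 <= tau) (kappa0 : 0 <= kappa) (b0 : 0 <= b).
Hypothesis Atau : forall w, enorm (A *m w) <= tau * enorm w.
Hypothesis resid : forall j, enorm ((A *m P - P *m T) *m iter j (mulmx T) v) <=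
  tau ^+ j * (kappa + b * (K <= j.+1)%:R).

(** With E = A P - P T, the difference D_j obeys D_(j+1) = A D_j + E T^j v and is a sum of j terms.
    The indicator is monotone in j, so its last value bounds all the others. [kappa] stands for
    errors present in every term, [b] for an error felt only once j + 1 reaches [K]. *)
Lemma power_intertwine j :
  enorm (iter j (mulmx A) (P *m v) - P *m iter j (mulmx T) v) <=
    j%:R * tau ^+ j.-1 * (kappa + b * (K <= j)%:R).
Proof.
elim: j => [|j IH]; first by rewrite subrr enorm0 !mul0r.
rewrite !iterS (_ : _ - _ = A *m (iter j (mulmx A) (P *m v) - P *m iter j (mulmx T) v)
   + (A *m P - P *m T) *m iter j (mulmx T) v); last first.
  by rewrite mulmxBr mulmxBl !mulmxA addrA subrK.
apply: le_trans (ler_enormD _ _) _.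
apply: le_trans (lerD (le_trans (Atau _) (ler_wpM2l tau0 IH)) (resid j)) _.
have mono : b * (K <= j)%:R <= b * (K <= j.+1)%:R.
  by rewrite ler_wpM2l// ler_nat; case: (leqP K j) => [/leqW ->|].
set k1 := b * _ in mono *; set k2 := b * _ in mono *.
have e : tau * (j%:R * tau ^+ j.-1 * (kappa + k1)) = j%:R * tau ^+ j * (kappa + k1).
  by case: (j) => [|i]; rewrite ?mul0r ?mulr0//= [tau ^+ i.+1]exprS; ring.
rewrite e -natr1 /= mulrDl mul1r mulrDl lerD2r ler_wpM2l ?lerD2l//.
by rewrite mulr_ge0 ?exprn_ge0.
Qed.

(* The factor [expR (j + 1 - K) >= 1] inserted in the terms with [K <= j + 1] turns
   the tail of the exponential series into a full series (Chernoff). *)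
Lemma taylor_intertwine D :
  enorm (taylor D A (P *m v) - P *m taylor D T v) <=
    kappa * expR tau + b * expR (1 - K%:R + expR 1 * tau).
Proof.
have -> : taylor D A (P *m v) - P *m taylor D T v = \sum_(j < D) j`!%:R^-1 *:
    (iter j (mulmx A) (P *m v) - P *m iter j (mulmx T) v).
  rewrite /taylor mulmx_sumr -sumrB; apply: eq_bigr => j _.
  by rewrite -scalemxAr scalerBr.
apply: le_trans (ler_enorm_sum _ _) _.
apply: (@le_trans _ _ (\sum_(j < D) j`!%:R^-1 *
    (j%:R * tau ^+ j.-1 * (kappa + b * (K <= j)%:R)))).
  apply: ler_sum => j _; rewrite enormZ ger0_norm ?fact_inv_ge0//.
  by rewrite ler_wpM2l ?fact_inv_ge0// power_intertwine.
have r0 : 0 <= kappa * expR tau + b * expR (1 - K%:R + expR 1 * tau).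
  by rewrite addr_ge0// mulr_ge0// expR_ge0.
(* The term j = 0 vanishes, and j / j! = 1 / (j - 1)! absorbs the factor j of [power_intertwine]. *)
case: D => [|D]; first by rewrite big_ord0.
rewrite big_ord_recl /= !mul0r mulr0 add0r.
apply: (@le_trans _ _ (kappa * exp_poly D tau
    + b * (expR (1 - K%:R) * exp_poly D (expR 1 * tau)))).
  rewrite /exp_poly !mulr_sumr -big_split /=; apply: ler_sum => j _.
  rewrite /bump add1n /= factS natrM invfM.
  have -> : (j.+1%:R^-1 * j`!%:R^-1) * (j.+1%:R * tau ^+ j * (kappa + b * (K <= j.+1)%:R))
      = kappa * (tau ^+ j / j`!%:R) + b * ((K <= j.+1)%:R * (tau ^+ j / j`!%:R)) :> R.
    have gen (a f p k c : R) : a != 0 -> f != 0 ->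
        (a^-1 * f^-1) * (a * p * (k + b * c)) = k * (p / f) + b * (c * (p / f)).
      by move=> *; field; apply/andP.
    by apply: gen; rewrite pnatr_eq0 -?lt0n ?fact_gt0.
  rewrite lerD2l ler_wpM2l// exprMn -expRM_natl mulr1.
  rewrite [leRHS](_ : _ = expR (1 - K%:R + j%:R) * (tau ^+ j / j`!%:R)); last first.
    by rewrite (expRD (1 - K%:R)); ring.
  apply: ler_wpM2r; first by rewrite mulr_ge0 ?exprn_ge0 ?fact_inv_ge0.
  case: (leqP K j.+1) => [h|_]; last exact: expR_ge0.
  apply: le_trans (expR_ge1Dx _); move: h; rewrite -(ler_nat R) -natr1 mulr1n; lra.
rewrite (expRD (1 - K%:R)) lerD ?ler_wpM2l ?expR_ge0 ?exp_poly_le//.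
by rewrite mulr_ge0 ?expR_ge0.
Qed.

End Intertwining.

Lemma enorm_orthogonal n (V : 'M[R]_n) w : V^T *m V = 1%:M -> enorm (V *m w) = enorm w.
Proof.
move=> VV; apply/eqP; rewrite -(eqrXn2 (n := 2)) ?enorm_ge0// !enorm_sqr.
by rewrite dotv_mulmxl mulmxA VV mul1mx.
Qed.

(** Both vectors are V applied to a diagonal action on V^T x, and V preserves norms; what remains is
    the scalar tail at each eigenvalue. *)
Lemma mxfun_exp_taylor n D (A : 'M[R]_n) tau x : A^T = A -> specnorm A <= tau ->
  enorm (mxfun expR A *m x - taylor D A x) <= (expR tau - exp_poly D tau) * enorm x.
Proof.
move=> As At; have [V [d [VV AE ->]]] := mxfunP expR As.
have VVt : V *m V^T = 1%:M by exact: mulmx1C.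
have t0 : 0 <= tau by rewrite (le_trans _ At)// specnorm_ge0.
(* Column i of V is a unit eigenvector, so A stretches it by |d_i|; one coordinate of its image in
   the eigenbasis already shows this. *)
have dt i : `|d 0 i| <= tau.
  have := enorm_mulmx A (V *m delta_mx i 0).
  rewrite {1}AE -!mulmxA (mulmxA V^T) VV mul1mx !(enorm_orthogonal (V := V))//.
  rewrite enorm_delta mulr1 => h; apply: le_trans At; apply: le_trans h.
  apply: le_trans (ler_coord_enorm _ i).
  by rewrite mul_diag_mx !mxE !eqxx mulr1.
have it j : iter j (mulmx A) x = V *m iter j (mulmx (diag_mx d)) (V^T *m x).
  elim: j => [|j IH]; first by rewrite /= mulmxA VVt mul1mx.
  by rewrite !iterS IH {1}AE -!mulmxA (mulmxA V^T) VV mul1mx.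
have -> : taylor D A x = V *m taylor D (diag_mx d) (V^T *m x).
  by rewrite /taylor mulmx_sumr; apply: eq_bigr => j _; rewrite it -scalemxAr.
rewrite -!mulmxA -mulmxBr enorm_orthogonal// -[enorm x](@enorm_orthogonal _ V^T) ?trmxK//.
have t1 : 0 <= expR tau - exp_poly D tau by rewrite subr_ge0 exp_poly_le.
move: (V^T *m x) => w; rewrite -[leRHS]addr0 -[X in _ <= _ + X](mul0r (enorm w)).
apply: ler_enorm_coord2 => // i; rewrite mul0r addr0 mul_diag_mx 2!mxE.
rewrite [X in _ + X]mxE taylor_diag mxE -mulrBl normrM ler_wpM2r//.
by rewrite exp_tail.
Qed.

End Taylor.

Lemma le_of_sqr (R : realDomainType) (x y : R) : 0 <= y -> x ^+ 2 <= y ^+ 2 -> x <= y.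
Proof.
move=> y0 xy; rewrite leNgt; apply/negP => yx.
have : 0 < (x - y) * (x + y) by rewrite mulr_gt0//; lra.
lra.
Qed.

(** * Rounding errors of the vector primitives *)

Section RoundingErrors.
Variables (R : realType) (M : machine R) (e : R).
Hypotheses (e0 : 0 <= e) (req1 : requirement1 M e).
Implicit Types (m n : nat).

Definition frob m n (A : 'M[R]_(m, n)) : R := Num.sqrt (\sum_i \sum_j A i j ^+ 2).

(* Each term of an inner product of length [n] goes through at most [n + 1] roundings. *)
Definition gam n : R := (1 + e) ^+ n.+1 - 1.

Lemma gamS n : gam n.+1 = gam n + e * (1 + gam n).
Proof. rewrite /gam [_ ^+ n.+2]exprS; ring. Qed.

Lemma gam_ge n : e <= gam n.
Proof.
have h0 := e0; elim: n => [|n IH]; first by rewrite /gam expr1; lra.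
have h : 0 <= e * gam n by rewrite mulr_ge0// (le_trans _ IH).
rewrite gamS; lra.
Qed.

Lemma gam_ge0 n : 0 <= gam n. Proof. exact: le_trans (gam_ge n). Qed.

Lemma le_gam n m : (n <= m)%N -> gam n <= gam m.
Proof. by move=> nm; rewrite lerD2r ler_weXn2l// lerDl. Qed.

Lemma gam_le n : 2 * n.+1%:R * e <= 1 -> gam n <= 2 * n.+1%:R * e.
Proof.
have h0 := e0; elim: n => [|n IH]; first by rewrite /gam expr1 mulr1; lra.
rewrite gamS -(natr1 n.+1); set N := n.+1%:R in IH * => h.
have h1 : 2 * N * e <= 1 by lra.
have g0 := gam_ge0 n; have g1 := IH h1.
have : 0 <= e * (1 - gam n) by rewrite mulr_ge0//; lra.
lra.
Qed.

Lemma rel_accurateP c x : rel_accurate e c x -> `|c - x| <= e * `|x|.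
Proof.
by case=> d [de ->]; rewrite mulrDl mul1r addrAC subrr add0r normrM ler_wpM2r.
Qed.

Lemma tfold_fst (I S : Type) (F : S -> I -> timed S) s0 r :
  (tfold F s0 r).1 = foldl (fun s i => (F s i).1) s0 r.
Proof.
rewrite /tfold -[s0 in RHS]/(tret s0).1.
by elim: r (tret s0) => //= i r IH c; rewrite IH.
Qed.

(** Cancellation forbids a bound relative to the inner product itself, hence the absolute values.
    Induction runs over the prefix already summed: [gamS] accounts for one more rounding of the
    partial sum, while the newest product has undergone only two roundings, which [gam_ge]
    covers. *)
Lemma fl_dot_abs n (u v : 'cV[R]_n) :
  `|(tdot M u v).1 - dotv u v| <= gam n * \sum_i `|u i 0 * v i 0|.
Proof.
have bE (F : 'I_n -> R) : \sum_i F i = \sum_(i <- enum 'I_n) F i.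
  by rewrite big_enum; apply: eq_bigl => i; rewrite inE.
rewrite /tdot tfold_fst /dotv !bE.
rewrite -[n in gam n](size_enum_ord n).
elim/last_ind: (enum 'I_n) => [|r i IH] /=; first by rewrite !big_nil subrr normr0 mulr0.
rewrite foldl_rcons /= size_rcons !big_rcons /=.
set s := foldl _ _ _ in IH *; set t := \sum_(_ <- _) _ in IH *.
set p := \sum_(_ <- _) `|_| in IH *.
have p0 : 0 <= p by apply: sumr_ge0.
case: req1 => radd _ rmul _ _.
have [d1 [h1 ->]] := rmul (u i 0) (v i 0).
set x := u i 0 * v i 0; have [d2 [h2 ->]] := radd s ((1 + d1) * x).
have tp : `|t| <= p by apply: ler_norm_sum.
have g0 := gam_ge (size r); rewrite gamS; set g := gam _ in g0 IH *.
rewrite [t + _]addrC (_ : _ - _ = (s - t) + d1 * x + d2 * (t + (s - t) + x + d1 * x)); last by ring.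
have x1 : `|d1 * x| <= e * `|x| by rewrite normrM ler_wpM2r.
have x2 : `|d2 * (t + (s - t) + x + d1 * x)| <= e * (p + g * p + `|x| + e * `|x|).
  rewrite normrM ler_pM//.
  apply: le_trans (ler_normD _ _) _; apply: lerD => //.
  apply: le_trans (ler_normD _ _) _; apply: lerD => //.
  by apply: le_trans (ler_normD _ _) _; apply: lerD.
apply: le_trans (ler_normD _ _) _; apply: le_trans (lerD (ler_normD _ _) x2) _.
have x3 : 0 <= (g - e) * `|x| by rewrite mulr_ge0// subr_ge0.
have x4 : 0 <= e * ((g - e) * `|x|) by rewrite mulr_ge0.
apply: le_trans (lerD (lerD IH x1) (lexx _)) _.
have := e0; rewrite -/x; nra.
Qed.

Lemma fl_dot n (u v : 'cV[R]_n) :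
  `|(tdot M u v).1 - dotv u v| <= gam n * (enorm u * enorm v).
Proof.
apply: le_trans (fl_dot_abs u v) _; rewrite ler_wpM2l ?gam_ge0//.
rewrite -(enorm_abs u) -(enorm_abs v); apply: le_trans (cauchy_schwarz _ _).
apply: le_trans (ler_norm _); rewrite le_eqVlt; apply/orP; left; apply/eqP.
by apply: eq_bigr => i _; rewrite !mxE normrM.
Qed.

(** A relative error [gam n] of the squared norm is at most as large after the square root. Rounding
    the root, itself at most twice the norm, adds 2 [e]; together 3 [gam n]. *)
Lemma fl_norm n (u : 'cV[R]_n) : gam n <= 1 ->
  0 <= (tnorm M u).1 * (1 - e) /\ `|(tnorm M u).1 - enorm u| <= 3 * gam n * enorm u.
Proof.
have h0 := e0; move=> g1; rewrite /tnorm /=; set s := (tdot M u u).1; set N := enorm u.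
have N0 : 0 <= N by exact: enorm_ge0.
have : `|s - N ^+ 2| <= gam n * N ^+ 2.
  by have := fl_dot u u; rewrite -/s -enorm_sqr expr2.
have g0 := gam_ge n; set g := gam n in g1 g0 *.
rewrite ler_norml => /andP[sl su].
have s0 : 0 <= s by nra.
case: req1 => _ _ _ _ /(_ s s0)[d [de ->]].
have r0 := sqrtr_ge0 s; have rs := sqr_sqrtr s0; set r := Num.sqrt s in r0 rs *.
move: de; rewrite ler_norml => /andP[dl du].
have e1 : e <= 1 by lra.
split; first by rewrite mulr_ge0 ?mulr_ge0//; lra.
have rN : - (g * N) <= r - N <= g * N.
  have h1 : 0 <= g * (1 - g) * N ^+ 2.
    by rewrite mulr_ge0 ?sqr_ge0// mulr_ge0//; lra.
  have h2 : 0 <= g * (1 + g) * N ^+ 2.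
    by rewrite mulr_ge0 ?sqr_ge0// mulr_ge0//; lra.
  have l1 : (1 - g) * N <= r.
    by apply: le_of_sqr => //; rewrite rs exprMn; lra.
  have l2 : r <= (1 + g) * N.
    by apply: le_of_sqr; [rewrite mulr_ge0//; lra|rewrite rs exprMn; lra].
  by apply/andP; split; lra.
have dr : `|d * r| <= e * (2 * N).
  have gN : g * N <= 1 * N by rewrite ler_wpM2r//; lra.
  rewrite normrM (ger0_norm r0) ler_pM//; first by rewrite ler_norml; lra.
  lra.
have eN : e * N <= g * N by rewrite ler_wpM2r.
move: dr rN; rewrite !ler_norml mulrDl mul1r; lra.
Qed.

Lemma fl_subscale n (u v : 'cV[R]_n) b : e <= 1 ->
  enorm ((tsubscale M u b v).1 - (u - b *: v)) <= e * enorm u + 3 * e * `|b| * enorm v.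
Proof.
move=> e1; apply: ler_enorm_coord2 => //; first by rewrite !mulr_ge0.
move=> i; rewrite !mxE /=; case: req1 => _ rsub rmul _ _.
have [d1 [h1 ->]] := rmul b (v i 0); set x := b * v i 0.
have [d2 [h2 ->]] := rsub (u i 0) ((1 + d1) * x).
have -> : 3 * e * `|b| * `|v i 0| = 3 * e * `|x| by rewrite normrM mulrA.
rewrite (_ : _ - _ = d2 * u i 0 + (- (d1 * x) - d2 * x - d2 * (d1 * x))); last by ring.
have x1 : `|d1 * x| <= e * `|x| by rewrite normrM ler_wpM2r.
have x2 : `|d2 * x| <= e * `|x| by rewrite normrM ler_wpM2r.
have x3 : `|d2 * (d1 * x)| <= e * `|x| by rewrite normrM -[leRHS]mul1r ler_pM// (le_trans h2).
have x4 : `|d2 * u i 0| <= e * `|u i 0| by rewrite normrM ler_wpM2r.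
apply: le_trans (ler_normD _ _) _; apply: lerD => //.
move: x1 x2 x3; rewrite !ler_norml; lra.
Qed.

Lemma fl_scale n (u : 'cV[R]_n) b :
  enorm ((tscale M b u).1 - b *: u) <= e * (`|b| * enorm u).
Proof.
rewrite mulrA -[leRHS]addr0 -[X in _ <= _ + X](mul0r (enorm u)).
apply: ler_enorm_coord2 => // [|i]; first by rewrite mulr_ge0.
rewrite mul0r addr0 !mxE /=; case: req1 => _ _ rmul _ _.
by rewrite -mulrA -normrM; apply: rel_accurateP.
Qed.

(** Multiplied out by [b], the form in which the new vector enters the three-term recurrence. *)
Lemma fl_divscale n (u : 'cV[R]_n) b : b != 0 ->
  enorm (b *: (tdivscale M u b).1 - u) <= e * enorm u.
Proof.
move=> b0; rewrite -[leRHS]addr0 -[X in _ <= _ + X](mul0r (enorm u)).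
apply: ler_enorm_coord2 => // i.
rewrite mul0r addr0 !mxE /=; case: req1 => _ _ _ /(_ (u i 0) _ b0)[d [h ->]] _.
rewrite (_ : _ - _ = d * u i 0); last by field.
by rewrite normrM ler_wpM2r.
Qed.

Lemma fl_mulmx p m (P : 'M[R]_(p, m)) u :
  enorm ((tmulmx M P u).1 - P *m u) <= gam m * (frob P * enorm u).
Proof.
have f0 : 0 <= frob P by exact: sqrtr_ge0.
have S0 : 0 <= \sum_i \sum_j P i j ^+ 2.
  by apply: sumr_ge0 => i _; apply: sumr_ge0 => j _; exact: sqr_ge0.
apply: enorm_le_sqr; first by rewrite !mulr_ge0 ?gam_ge0 ?enorm_ge0.
rewrite !exprMn sqr_sqrtr// mulrA mulr_sumr mulr_suml; apply: ler_sum => i _.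
rewrite -expr2 -(real_normK (num_real _)).
rewrite mxE [X in _ + X]mxE row_dotv mxE /=.
apply: (@le_trans _ _ ((gam m * (enorm (row i P)^T * enorm u)) ^+ 2)).
  by rewrite ler_sqr ?nnegrE ?mulr_ge0 ?gam_ge0 ?enorm_ge0// fl_dot.
rewrite !exprMn mulrA (enorm_sqr (row i P)^T) ler_wpM2r ?sqr_ge0// ler_wpM2l ?sqr_ge0//.
by rewrite le_eqVlt; apply/orP; left; apply/eqP; apply: eq_bigr => j _; rewrite !mxE expr2.
Qed.

Lemma frob_cols p m (P : 'M[R]_(p, m)) c : 0 <= c ->
  (forall j, enorm (col j P) <= c) -> frob P <= m%:R * c.
Proof.
move=> c0 h; rewrite -(ler_sqr (R := R)) ?nnegrE ?sqrtr_ge0 ?mulr_ge0//.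
rewrite sqr_sqrtr; last by apply: sumr_ge0 => i _; apply: sumr_ge0 => j _; exact: sqr_ge0.
rewrite exchange_big /=; apply: (@le_trans _ _ (\sum_(j < m) c ^+ 2)).
  apply: ler_sum => j _; apply: (@le_trans _ _ (enorm (col j P) ^+ 2)); last first.
    by rewrite ler_sqr ?nnegrE ?enorm_ge0.
  rewrite enorm_sqr le_eqVlt; apply/orP; left; apply/eqP; apply: eq_bigr => i _.
  by rewrite !mxE expr2.
rewrite sumr_const card_ord exprMn -[c ^+ 2 *+ m]mulr_natl ler_wpM2r ?sqr_ge0//.
by rewrite -natrX ler_nat; case: (m) => // k; rewrite leq_pmull.
Qed.

Lemma frob_tr p m (P : 'M[R]_(p, m)) : frob P^T = frob P.
Proof.
rewrite /frob exchange_big /=; congr Num.sqrt.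
by apply: eq_bigr => i _; apply: eq_bigr => j _; rewrite mxE.
Qed.

(** Here [b] is the computed norm of [u] and [q] the computed quotient. The errors 3 g and g add up
    to 4 g, and the fifth g absorbs the second-order terms. *)
Lemma fl_normalize n (u : 'cV[R]_n) b q : 100 * gam n <= 1 -> b != 0 ->
  `|b - enorm u| <= 3 * gam n * enorm u -> enorm (b *: q - u) <= gam n * enorm u ->
  `|enorm q - 1| <= 5 * gam n.
Proof.
have g0 := gam_ge0 n; set g := gam n in g0 *; move=> g1 b0 hb hq.
have N0 := enorm_ge0 u; set N := enorm u in N0 hb hq.
have bp : 0 < b.
  rewrite lt0r b0 /=; move: hb; have : 3 * g * N <= 1 * N by rewrite ler_wpM2r//; lra.
  rewrite ler_norml; lra.
have h1 : enorm (b *: q) <= (1 + g) * N.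
  by have := ler_enorm_dist (b *: q) u; rewrite -/N; lra.
have h2 : (1 - g) * N <= enorm (b *: q).
  by have := ler_enorm_dist u (b *: q); rewrite enormBC -/N; lra.
have q0 := enorm_ge0 q; move: h1 h2; rewrite enormZ gtr0_norm// => h1 h2.
move: hb; rewrite ler_norml => /andP[hb1 hb2].
have gg : 0 <= g * (1 - 15 * g) * N by rewrite mulr_ge0// mulr_ge0//; lra.
have gg2 : 0 <= g * (1 + 15 * g) * N by rewrite mulr_ge0// mulr_ge0//; lra.
rewrite ler_norml; apply/andP; split.
  rewrite -(ler_pM2l bp).
  have : b * (1 - 5 * g) <= (N + 3 * g * N) * (1 - 5 * g) by rewrite ler_wpM2r; lra.
  lra.
rewrite -(ler_pM2l bp).
have : (N - 3 * g * N) * (1 + 5 * g) <= b * (1 + 5 * g) by rewrite ler_wpM2r; lra.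
lra.
Qed.

End RoundingErrors.

(** * One Lanczos iteration in floating point *)

Section LanczosInvariant.
Variables (R : realType) (M : machine R) (e h : R) (n : nat) (A : 'M[R]_n).
Hypotheses (e0 : 0 <= e) (req1 : requirement1 M e) (req2 : requirement2 M A e).
Hypotheses (Asym : A^T = A) (gh : gam e n <= h) (mvh : 2 * n%:R `^ (3 / 2) * e <= h).
Hypothesis h1 : 10 ^+ 5 * h <= 1.
Implicit Types (q qp : 'cV[R]_n).

Let a := specnorm A.
Let eta := 600 * h.

(** The expansions below contain squared norms. The constant 11 covers twice the error 5 h of a
    normalised vector, plus its square. *)
Definition almost_unit q := `|dotv q q - 1| <= 11 * h.

Lemma almost_unit_enorm q : `|enorm q - 1| <= 5 * h -> almost_unit q.
Proof.
rewrite /almost_unit -enorm_sqr => qh; have h0 : 0 <= h by exact: le_trans (gam_ge0 e0 n) gh.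
rewrite (_ : _ - 1 = (enorm q - 1) * 2 + (enorm q - 1) * (enorm q - 1)); last by ring.
have q1 : `|(enorm q - 1) * (enorm q - 1)| <= h.
  rewrite normrM; apply: le_trans (ler_pM _ _ qh qh) _ => //.
  have : 0 <= h * (1 - 25 * h) by rewrite mulr_ge0//; move: h1; lra.
  lra.
move: q1 qh; rewrite !ler_norml; lra.
Qed.

Lemma almost_unit_le q : almost_unit q -> enorm q <= 1 + 11 * h.
Proof.
have h0 : 0 <= h by exact: le_trans (gam_ge0 e0 n) gh.
rewrite /almost_unit -enorm_sqr ler_norml => /andP[_ hq].
apply: le_of_sqr; first lra.
have := sqr_ge0 h; lra.
Qed.

Lemma almost_unit_le2 q : almost_unit q -> enorm q <= 2.
Proof. by move=> /almost_unit_le; have := h1; lra. Qed.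

Lemma ler_absM (x y X Y : R) : `|x| <= X -> `|y| <= Y -> `|x * y| <= X * Y.
Proof. by move=> xX yY; rewrite normrM ler_pM. Qed.

Lemma dotv_le (u v : 'cV[R]_n) X Y : enorm u <= X -> enorm v <= Y -> `|dotv u v| <= X * Y.
Proof.
move=> uX vY; apply: le_trans (cauchy_schwarz u v) _.
by rewrite ler_pM// enorm_ge0.
Qed.

Definition step_w1 q qp b := (tsubscale M (fl_mv M A q) b qp).1.
Definition step_alpha q qp b := (tdot M (step_w1 q qp b) q).1.
Definition step_w2 q qp b := (tsubscale M (step_w1 q qp b) (step_alpha q qp b) q).1.
Definition step_beta q qp b := (tnorm M (step_w2 q qp b)).1.
(** At a breakdown the algorithm forms no further vector; the value 0 keeps the three-term
    recurrence valid at that index. *)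
Definition step_q q qp b :=
  if step_beta q qp b == 0 then 0 else (tdivscale M (step_w2 q qp b) (step_beta q qp b)).1.

(* [(qp, q, b, al, b', q')] stand for q_(i-1), q_i, beta_i, alpha_i, beta_(i+1), q_(i+1). *)
Definition local_step qp q b al b' q' :=
  [/\ 0 <= b' <= 46 * a, `|al| <= 17 * a, enorm q' <= 2 /\ (b' = 0 \/ almost_unit q'),
      enorm (A *m q - (b' *: q' + al *: q + b *: qp)) <= eta * a &
      `|b' * dotv q q'| <= eta * a].

(** The sizes grow along the iteration as 3 a, 8 a, 17 a, 44 a, 46 a for [w0], [w1], [al], [w2],
    [b']. The four rounding errors 2, 15, 110 and 44, in units of h a, add up to the residual of the
    recurrence and stay below 600. *)
Lemma lanczos_local qp q b : almost_unit q -> enorm qp <= 2 -> 0 <= b <= 2 * a ->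
  local_step qp q b (step_alpha q qp b) (step_beta q qp b) (step_q q qp b).
Proof.
move=> uq qp2 /andP[b0 b2].
have eh : e <= h by exact: le_trans (gam_ge e0 n) gh.
have h0 : 0 <= h by exact: le_trans e0 eh.
have h1' := h1; have gh' := gh; have a0 : 0 <= a by exact: specnorm_ge0.
have ha0 : 0 <= h * a by rewrite mulr_ge0.
have ha1 : 10 ^+ 5 * (h * a) <= a.
  by have : (10 ^+ 5 * h) * a <= 1 * a; [rewrite ler_wpM2r | lra].
have q2 : enorm q <= 2 by exact: almost_unit_le2.
have Aq : enorm (A *m q) <= 2 * a.
  by apply: le_trans (enorm_mulmx A q) _; rewrite mulrC ler_wpM2r.
set w0 := fl_mv M A q.
have d0 : enorm (w0 - A *m q) <= 2 * (h * a).
  apply: le_trans (req2 q) _; rewrite -/a.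
  have -> : 2 * n%:R `^ (3 / 2) * a * enorm q * e = (2 * n%:R `^ (3 / 2) * e) * (a * enorm q) by ring.
  apply: le_trans (_ : h * (a * enorm q) <= _).
    by rewrite ler_wpM2r// mulr_ge0// enorm_ge0.
  have : h * a * enorm q <= h * a * 2 by rewrite ler_wpM2l.
  lra.
have w03 : enorm w0 <= 3 * a by have := ler_enorm_dist w0 (A *m q); lra.
have e1 : e <= 1 by lra.
set w1 := step_w1 q qp b.
have d1 : enorm (w1 - (w0 - b *: qp)) <= 15 * (h * a).
  apply: le_trans (fl_subscale e0 req1 w0 qp b e1) _.
  have t1 : e * enorm w0 <= h * (3 * a) by rewrite ler_pM// enorm_ge0.
  have t2 : (3 * e * `|b|) * enorm qp <= (3 * h * (2 * a)) * 2.
    by rewrite ler_pM ?mulr_ge0 ?enorm_ge0// ler_pM ?mulr_ge0// ?ger0_norm// ler_wpM2l.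
  lra.
have bqp : enorm (b *: qp) <= 4 * a.
  rewrite enormZ ger0_norm//.
  by have : b * enorm qp <= (2 * a) * 2; [rewrite ler_pM// enorm_ge0 | lra].
have w18 : enorm w1 <= 8 * a.
  have := ler_enorm_dist w1 (w0 - b *: qp); have := ler_enormB w0 (b *: qp); lra.
set al := step_alpha q qp b.
have dal : `|al - dotv w1 q| <= 16 * (h * a).
  apply: le_trans (fl_dot e0 req1 w1 q) _.
  have : gam e n * (enorm w1 * enorm q) <= h * ((8 * a) * 2).
    by rewrite ler_pM ?gam_ge0 ?mulr_ge0 ?enorm_ge0// ler_pM ?enorm_ge0.
  lra.
have al17 : `|al| <= 17 * a.
  by have := dotv_le w18 q2; move: dal; rewrite !ler_norml; lra.
set w2 := step_w2 q qp b.
have d2 : enorm (w2 - (w1 - al *: q)) <= 110 * (h * a).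
  apply: le_trans (fl_subscale e0 req1 w1 q al e1) _.
  have t1 : e * enorm w1 <= h * (8 * a) by rewrite ler_pM// enorm_ge0.
  have t2 : (3 * e * `|al|) * enorm q <= (3 * h * (17 * a)) * 2.
    by rewrite ler_pM ?mulr_ge0 ?enorm_ge0// ler_pM ?mulr_ge0// ler_wpM2l.
  lra.
have alq : enorm (al *: q) <= 34 * a.
  rewrite enormZ.
  by have : `|al| * enorm q <= (17 * a) * 2; [rewrite ler_pM// enorm_ge0 | lra].
have w244 : enorm w2 <= 44 * a.
  have := ler_enorm_dist w2 (w1 - al *: q); have := ler_enormB w1 (al *: q); lra.
set b' := step_beta q qp b; set q' := step_q q qp b.
have g1 : gam e n <= 1 by lra.
have [b'0 db'] : 0 <= b' * (1 - e) /\ `|b' - enorm w2| <= 3 * gam e n * enorm w2.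
  exact: fl_norm.
have {}b'0 : 0 <= b' by rewrite -(pmulr_lge0 _ (_ : 0 < 1 - e))//; lra.
have gw2 : gam e n * enorm w2 <= h * (44 * a) by rewrite ler_pM ?gam_ge0 ?enorm_ge0.
have b'46 : b' <= 46 * a by move: db'; rewrite ler_norml; lra.
have [dq' q'2 uq'] : [/\ enorm (b' *: q' - w2) <= 44 * (h * a), enorm q' <= 2 &
    b' = 0 \/ almost_unit q'].
  (* A vanishing computed norm has relative error below 1/2 only if [w2] itself vanishes, so the
     choice q' = 0 loses nothing. *)
  rewrite /q' /step_q -/b'; case: eqVneq => [b'E|b'N].
    split; rewrite ?enorm0//; last by left.
    rewrite scaler0 sub0r enormN; move: db'; rewrite b'E sub0r normrN (ger0_norm (enorm_ge0 _)).
    have : 3 * gam e n * enorm w2 <= 1 / 2 * enorm w2.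
      by rewrite ler_wpM2r ?enorm_ge0//; lra.
    lra.
  have dv := fl_divscale e0 req1 w2 b'N.
  have dv' : enorm (b' *: (tdivscale M w2 b').1 - w2) <= gam e n * enorm w2.
    by apply: le_trans dv _; rewrite ler_wpM2r ?enorm_ge0// gam_ge.
  have qn := fl_normalize e0 _ b'N db' dv'.
  have {}qn : `|enorm (tdivscale M w2 b').1 - 1| <= 5 * h.
    by apply: le_trans (qn _) _; lra.
  split; first lra.
    by move: qn; rewrite ler_norml; lra.
  by right; apply: almost_unit_enorm.
split => //; first by rewrite b'0.
  have -> : A *m q - (b' *: q' + al *: q + b *: qp) =
      - (w0 - A *m q) - (w1 - (w0 - b *: qp)) - (w2 - (w1 - al *: q)) - (b' *: q' - w2).
    by apply/matrixP => i j; rewrite !mxE; ring.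
  apply: le_trans (ler_enormB _ _) _.
  apply: le_trans (lerD (ler_enormB _ _) (lexx _)) _.
  apply: le_trans (lerD (lerD (ler_enormB _ _) (lexx _)) (lexx _)) _.
  rewrite enormN /eta; lra.
(* [b' * dotv q q'] splits into the errors of [q'] and [w2] tested against [q], the error of [al],
   and [al] times the defect of the norm of [q]: 88 + 220 + 16 + 187 = 511 units of h a, again below
   600. *)
have c1 := dotv_le q2 dq'; have c2 := dotv_le q2 d2.
have c3 : `|al * (dotv q q - 1)| <= (17 * a) * (11 * h) by exact: ler_absM.
move: c1 c2 c3 dal; rewrite !(dotvBr, dotvZr) !ler_norml (dotvC w1 q) /eta => c1 c2 c3 dal.
apply/andP; split; lra.
Qed.

(** [theta] bounds the one defect that accumulates: in exact arithmetic b <q, A qp> = b^2, because A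
    qp has component b along q. The alternative [b = 0] admits the start, where q_0 = 0 is not a
    unit vector. *)
Definition lanczos_inv theta qp q b :=
  [/\ almost_unit q, enorm qp <= 2, 0 <= b <= 2 * a, b = 0 \/ almost_unit qp &
      `|b * dotv qp q| <= eta * a /\ `|b * dotv q (A *m qp) - b ^+ 2| <= theta].

Definition row_bound b al b' := b ^+ 2 + al ^+ 2 + b' ^+ 2 <= 27 / 25 * a ^+ 2.

End LanczosInvariant.

(* Although q_(i-1) and q_(i+1) need not be nearly orthogonal when beta_i is tiny,
   [y = beta_i beta_(i+1) <q_(i-1), q_(i+1)>] is small: symmetry of A gives a recurrence
   in which its rounding errors merely add up. *)
Lemma lanczos_step (R : realType) (e h : R) n (A : 'M[R]_n) theta (qp q : 'cV[R]_n) b al b' q' :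
  0 <= e -> A^T = A -> gam e n <= h -> 10 ^+ 5 * h <= 1 ->
  let a := specnorm A in let eta := 600 * h in
  0 <= theta -> 2 * theta + 2600 * eta * a ^+ 2 <= 2 / 25 * a ^+ 2 ->
  lanczos_inv h A theta qp q b -> local_step h A qp q b al b' q' ->
  row_bound A b al b' /\ (b' = 0 \/ lanczos_inv h A (theta + 2250 * eta * a ^+ 2) q q' b').
Proof.
move=> e0 Asym gh h1 a eta th0 thS [uq qp2 /andP[b0 b2] uqp [hc hth]] [/andP[b'0 b'46] al17 [q'2 uq'] hf hc'].
rewrite -/a -/eta in hc hf hc' al17 b2 b'46.
have h0 : 0 <= h by exact: le_trans (gam_ge0 e0 n) gh.
have a0 : 0 <= a by exact: specnorm_ge0.
have eta0 : 0 <= eta by clear -h0; rewrite /eta; lra.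
have eta1 : eta <= 1 / 100 by clear -h1 h0; rewrite /eta; lra.
have eh : 11 * h <= eta by clear -h0; rewrite /eta; lra.
have a2 := sqr_ge0 a.
have s0 : 0 <= eta * a ^+ 2 by rewrite mulr_ge0.
set f := A *m q - _ in hf.
have AqE : A *m q = b' *: q' + al *: q + b *: qp + f by rewrite /f addrC subrK.
have q2 : enorm q <= 2 by exact: almost_unit_le2 e0 gh h1 q uq.
have q1 : enorm q <= 1 + eta.
  by apply: le_trans (almost_unit_le e0 gh uq) _; rewrite lerD2l.
have sym : dotv q (A *m qp) = dotv qp (A *m q) by rewrite dotvC dotv_mulmxl Asym.
pose y := b * b' * dotv qp q'.
have babs : `|b| <= 2 * a by rewrite ger0_norm.
have b'abs : `|b'| <= 46 * a by rewrite ger0_norm.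
have nrmb x u B : 0 <= B -> `|x| <= B -> (x = 0 \/ almost_unit h u) ->
    `|x ^+ 2 * (dotv u u - 1)| <= B ^+ 2 * eta.
  move=> B0 xB [->|uu]; first by rewrite expr0n mul0r normr0 mulr_ge0 ?sqr_ge0.
  apply: ler_absM; last exact: le_trans uu eh.
  by rewrite normrX ler_sqr ?nnegrE.
have N1 : `|b ^+ 2 * (dotv qp qp - 1)| <= (2 * a) ^+ 2 * eta by apply: nrmb => //; exact: mulr_ge0.
have N2 : `|al ^+ 2 * (dotv q q - 1)| <= (17 * a) ^+ 2 * eta.
  by apply: nrmb => //; [exact: mulr_ge0 | right].
have N3 : `|b' ^+ 2 * (dotv q' q' - 1)| <= (46 * a) ^+ 2 * eta by apply: nrmb => //; exact: mulr_ge0.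
have C1 : `|al * (b * dotv qp q)| <= (17 * a) * (eta * a) by exact: ler_absM.
have C2 : `|al * (b' * dotv q q')| <= (17 * a) * (eta * a) by exact: ler_absM.
have F1 : `|b * dotv qp f| <= (2 * a) * (2 * (eta * a)) by apply: ler_absM => //; exact: dotv_le.
have F2 : `|b' * dotv q' f| <= (46 * a) * (2 * (eta * a)).
  by apply: ler_absM => //; exact: dotv_le.
(* By symmetry <q, A qp> = <qp, A q>, and the recurrence for A q turns the inherited defect into
   [y]. The extra constant is 25 = 17 + 4 + 4, from [C1], [N1] and [F1]. *)
have yb : `|y| <= theta + 25 * (eta * a ^+ 2).
  have yE : y = (b * dotv q (A *m qp) - b ^+ 2) - al * (b * dotv qp q)
      - b ^+ 2 * (dotv qp qp - 1) - b * dotv qp f.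
    by rewrite sym AqE !(dotvDr, dotvZr) /y; ring.
  clear -yE hth C1 N1 F1; move: hth C1 N1 F1; rewrite yE !ler_norml; lra.
(* Expanding the squared norm of A q - f gives the three squares plus cross terms that are all
   small, [y] included. The errors sum to 2 theta + 2532 eta a^2, within the slack 2/25 a^2 between
   27/25 and 1. *)
have rb : row_bound A b al b'.
  have gn : enorm (A *m q - f) <= a * (1 + 2 * eta).
    apply: le_trans (ler_enormB _ _) _.
    have t : enorm (A *m q) <= a * (1 + eta).
      by apply: le_trans (enorm_mulmx A q) _; rewrite ler_wpM2l.
    by apply: le_trans (lerD t hf) _; clear; lra.
  have g2 : dotv (A *m q - f) (A *m q - f) <= a ^+ 2 * (1 + 5 * eta).
    rewrite -enorm_sqr.
    have g3 : enorm (A *m q - f) ^+ 2 <= (a * (1 + 2 * eta)) ^+ 2.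
      by rewrite ler_sqr ?nnegrE ?enorm_ge0// mulr_ge0//; clear -eta0; lra.
    apply: le_trans g3 _; rewrite exprMn ler_wpM2l//.
    have t : 0 <= eta * (1 - 4 * eta) by rewrite mulr_ge0//; clear -eta1; lra.
    by clear -t; lra.
  have gE : dotv (A *m q - f) (A *m q - f) = b' ^+ 2 * dotv q' q' + al ^+ 2 * dotv q q
     + b ^+ 2 * dotv qp qp + 2 * (al * (b' * dotv q q')) + 2 * (al * (b * dotv qp q)) + 2 * y.
    rewrite AqE addrK !(dotvDr, dotvDl, dotvZr, dotvZl) (dotvC q' q) (dotvC q' qp) (dotvC q qp) /y.
    by ring.
  rewrite /row_bound -/a; rewrite gE in g2; clear -N1 N2 N3 C1 C2 yb g2 s0 thS th0.
  by move: N1 N2 N3 C1 C2 yb; rewrite !ler_norml; lra.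
split => //.
case: uq' => [b'E|uq']; [by left | right].
split => //; last 1 first.
(* The increment is 2250 = 46^2 + 17 + 25 + 92, from [N3], [C2], [yb] and [F2]; [theta] itself is
   passed on with factor 1, which prevents exponential growth. *)
- split; first by [].
  have sE : b' * dotv q' (A *m q) - b' ^+ 2 = b' ^+ 2 * (dotv q' q' - 1)
      + al * (b' * dotv q q') + y + b' * dotv q' f.
    by rewrite AqE !(dotvDr, dotvZr) (dotvC q' q) (dotvC q' qp) /y; ring.
  clear -N3 C2 yb F2 sE s0 th0; move: N3 C2 yb F2; rewrite sE !ler_norml; lra.
(* The row bound improves the a priori estimate 46 a to 2 a, so the size constants do not compound
   from one iteration to the next. *)
- rewrite b'0; apply: le_of_sqr; first exact: mulr_ge0.
  have := sqr_ge0 b; have := sqr_ge0 al; clear -rb a2; move: rb; rewrite /row_bound -/a; lra.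
- by right.
Qed.

Lemma budget_ge0 (R : realFieldType) (x y j : R) :
  0 <= x * y * j -> 0 <= 2250 * x * y * j.
Proof. lra. Qed.

Lemma loop_budget (R : realFieldType) (j k x y : R) :
  (4500 * (j + k) + 2600) * x * y <= 2 / 25 * y -> 0 <= k * (x * y) ->
  2 * (2250 * x * y * j) + 2600 * x * y <= 2 / 25 * y.
Proof. lra. Qed.

(** * Induction along the Lanczos loop *)

Section LanczosLoop.
Variables (R : realType) (M : machine R) (e h : R) (n : nat) (A : 'M[R]_n).
Hypotheses (e0 : 0 <= e) (req1 : requirement1 M e) (req2 : requirement2 M A e).
Hypotheses (Asym : A^T = A) (gh : gam e n <= h) (mvh : 2 * n%:R `^ (3 / 2) * e <= h).
Hypothesis h1 : 10 ^+ 5 * h <= 1.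
Implicit Types (q qp : 'cV[R]_n).

Let a := specnorm A.
Let eta := 600 * h.

Lemma lanczos_loopS k qp q b : (lanczos_loop M A k.+1 qp q b).1 =
  (step_alpha M A q qp b, step_beta M A q qp b, q) ::
  if step_beta M A q qp b == 0 then [::]
  else (lanczos_loop M A k q (step_q M A q qp b) (step_beta M A q qp b)).1.
Proof.
rewrite /step_q /=.
by rewrite /step_beta /step_w2 /step_alpha /step_w1 /=; case: eqP.
Qed.

(** For the loop started at q_1, [qf i] is q_i, whereas [al i] is alpha_(i+1) and [bt i] is
    beta_(i+1); so row i of T, counted from 0, involves [bt i], [al i] and [bt i.+1]. *)
Definition recurrence (qf : nat -> 'cV[R]_n) (al bt : nat -> R) i :=
  [/\ row_bound A (bt i) (al i) (bt i.+1), 0 <= bt i.+1,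
      enorm (qf i.+1) <= 2, enorm (qf i.+2) <= 2 &
      enorm (A *m qf i.+1 - (bt i.+1 *: qf i.+2 + al i *: qf i.+1 + bt i *: qf i)) <= eta * a].

(** [j] counts the iterations done and [k] those left, so the budget in j + k is unchanged by the
    recursion. Infinite sequences replace the list because the residual at the last index involves a
    vector that the loop does not return. *)
Lemma lanczos_loopP k qp q b j :
  (4500 * (j + k)%:R + 2600) * eta <= 2 / 25 ->
  lanczos_inv h A (2250 * eta * a ^+ 2 * j%:R) qp q b ->
  let s := (lanczos_loop M A k qp q b).1 in
  exists (qf : nat -> 'cV[R]_n) (al bt : nat -> R),
  [/\ qf 0%N = qp, qf 1%N = q, bt 0%N = b,
      [/\ (size s <= k)%N, (0 < k)%N -> (0 < size s)%N & size s = k \/ bt (size s) = 0] &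
      forall i, (i < size s)%N ->
        nth (0, 0, 0) s i = (al i, bt i.+1, qf i.+1) /\ recurrence qf al bt i].
Proof.
have h0 : 0 <= h by exact: le_trans (gam_ge0 e0 n) gh.
have eta0 : 0 <= eta by rewrite /eta; lra.
elim: k qp q b j => [|k IH] qp q b j hk inv; lazy zeta.
  rewrite [lanczos_loop _ _ _ _ _ _]/=.
  exists (fun i => if i is 0%N then qp else q), (fun=> 0), (fun=> b).
  by split=> //; split=> //; left.
have a2 : 0 <= a ^+ 2 by exact: sqr_ge0.
have [uq qp2 bb uqp _] := inv.
have loc := lanczos_local e0 req1 req2 gh mvh h1 uq qp2 bb.
have t0 : 0 <= eta * a ^+ 2 * j%:R by rewrite mulr_ge0// mulr_ge0.
have th0 : 0 <= 2250 * eta * a ^+ 2 * j%:R by exact: budget_ge0.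
have thS : 2 * (2250 * eta * a ^+ 2 * j%:R) + 2600 * eta * a ^+ 2 <= 2 / 25 * a ^+ 2.
  have t1 : (4500 * (j + k.+1)%:R + 2600) * eta * a ^+ 2 <= 2 / 25 * a ^+ 2 by rewrite ler_wpM2r.
  have t2 : 0 <= k.+1%:R * (eta * a ^+ 2) by rewrite mulr_ge0// mulr_ge0.
  by move: t1 t2; rewrite natrD; exact: loop_budget.
have [rb inv'] := lanczos_step e0 Asym gh h1 th0 thS inv loc.
have [/andP[b'0 _] _ [q'2 _] res _] := loc.
have q2 : enorm q <= 2.
  exact: (almost_unit_le2 e0 gh h1 uq).
rewrite lanczos_loopS.
set al0 := step_alpha M A q qp b; set b' := step_beta M A q qp b; set q' := step_q M A q qp b.
have [b'E|b'N] := eqVneq b' 0.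
  exists (fun i => if i is i'.+1 then (if i' is 0%N then q else q') else qp), (fun=> al0),
    (fun i => if i is 0%N then b else b').
  split=> //; first by split=> //; right.
  by case=> // _; split.
case: inv' => [/eqP|inv']; first by rewrite (negPf b'N).
have inv2 : lanczos_inv h A (2250 * eta * a ^+ 2 * j.+1%:R) q q' b'.
  by rewrite -(natr1 j) mulrDr mulr1.
have hk2 : (4500 * (j.+1 + k)%:R + 2600) * eta <= 2 / 25 by rewrite addSnnS.
have := IH q q' b' j.+1 hk2 inv2 => -[] qf [al [bt [qf0 qf1 bt0 [sk s0 sE] hi]]].
exists (fun i => if i is i'.+1 then qf i' else qp), (fun i => if i is i'.+1 then al i' else al0),
  (fun i => if i is i'.+1 then bt i' else b).
split=> //; first by split=> //=; case: sE => [->|]; [left|right].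
case=> [|i] /=; last by rewrite ltnS => /hi.
move=> _; rewrite qf0 bt0; split=> //; split=> //; rewrite ?qf1 ?qf0 ?bt0 //.
Qed.

End LanczosLoop.

(** * The tridiagonal matrix and the Krylov residual *)

Section Tridiagonal.
Variable R : realType.

Definition trid m (al bt : nat -> R) : 'M[R]_m :=
  \matrix_(i, j) if i == j then al i else if j == i.+1 :> nat then bt i.+1
    else if i == j.+1 :> nat then bt j.+1 else 0.

Definition krylov n m (qf : nat -> 'cV[R]_n) : 'M[R]_(n, m) := \matrix_(i, j) qf j.+1 i 0.

Lemma lanczos_T_trid n (s : seq (R * R * 'cV[R]_n)) al bt qf :
  (forall i, (i < size s)%N -> nth (0, 0, 0) s i = (al i, bt i.+1, qf i.+1)) ->
  lanczos_T s = trid (size s) al bt.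
Proof. by move=> h; apply/matrixP => i j; rewrite !mxE !h. Qed.

Lemma lanczos_Q_krylov n (s : seq (R * R * 'cV[R]_n)) al bt qf :
  (forall i, (i < size s)%N -> nth (0, 0, 0) s i = (al i, bt i.+1, qf i.+1)) ->
  lanczos_Q s = krylov (size s) qf.
Proof. by move=> h; apply/matrixP => i j; rewrite !mxE !h. Qed.

Lemma trid_symtridiag m al bt : symtridiag (trid m al bt).
Proof.
split=> [|i j ij]; last first.
  rewrite mxE; case: eqVneq => [E|_]; first by move: ij; rewrite E ltnNge leqnSn.
  by rewrite gtn_eqF// ltn_eqF// (leq_trans _ (leqW (ltnW ij))).
apply/matrixP => i j; rewrite !mxE eq_sym; case: eqVneq => [->//|_].
case: eqP => [->|_]; last by [].
by rewrite ltn_eqF.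
Qed.

Lemma sum_ord_if (V : nmodType) m c (f : nat -> V) :
  \sum_(i < m) (if i == c :> nat then f i else 0) = if (c < m)%N then f c else 0.
Proof. by rewrite -big_mkcond /= big_ord1_eq. Qed.

Lemma sum_ord_if_pred (V : nmodType) m c (f : nat -> V) :
  \sum_(i < m) (if c == i.+1 :> nat then f i else 0) =
    if (c.-1 < m)%N && (0 < c)%N then f c.-1 else 0.
Proof.
case: c => [|c] /=; first by rewrite andbF big1.
by rewrite andbT -sum_ord_if; apply: eq_bigr => i _; rewrite eqSS eq_sym.
Qed.

Lemma trid_split m al bt (i j : 'I_m) : trid m al bt i j =
  (if i == j :> nat then al i else 0) + (if j == i.+1 :> nat then bt i.+1 else 0)
  + (if i == j.+1 :> nat then bt j.+1 else 0).
Proof.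
rewrite mxE -val_eqE /=; case: eqVneq => [->|_]; first by rewrite ltn_eqF// !addr0.
case: eqVneq => [->|_]; last by rewrite !add0r.
by rewrite ltn_eqF ?add0r ?addr0.
Qed.

(** The convention q_0 = 0 gives the first column the same shape as the others; the last one lacks
    its third term. *)
Lemma krylov_trid_col n m qf al bt (j : 'I_m) : qf 0%N = 0 ->
  \sum_(i < m) trid m al bt i j *: (qf i.+1 : 'cV[R]_n) =
  bt j *: qf j + al j *: qf j.+1 + (if (j.+1 < m)%N then bt j.+1 *: qf j.+2 else 0).
Proof.
move=> qf0.
have scl (b : bool) x (v : 'cV[R]_n) : (if b then x else 0) *: v = if b then x *: v else 0.
  by case: b; rewrite ?scale0r.
under eq_bigr => i _ do rewrite trid_split !scalerDl !scl.
rewrite !big_split /= (sum_ord_if m j (fun i => al i *: qf i.+1)) ltn_ord.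
rewrite (sum_ord_if_pred m j (fun i => bt i.+1 *: qf i.+1)).
rewrite (sum_ord_if m j.+1 (fun i => bt j.+1 *: qf i.+1)).
rewrite [al j *: _ + _]addrC; congr (_ + _ + _).
case: j => [[|j] jm] /=; first by rewrite andbF qf0 scaler0.
by rewrite andbT ltnW.
Qed.

(** The columns of A Q - Q T are the residuals of the recurrence, except that the last one also
    contains beta_(m+1) q_(m+1). This is not small, so it is kept apart, weighted by the last
    coordinate of [v]. *)
Lemma krylov_residual n m (A : 'M[R]_n) qf al bt (c d : R) (v : 'cV[R]_m) :
  0 <= c -> 0 <= d -> qf 0%N = 0 ->
  (forall i, (i < m)%N ->
     enorm (A *m qf i.+1 - (bt i.+1 *: qf i.+2 + al i *: qf i.+1 + bt i *: qf i)) <= c) ->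
  ((0 < m)%N -> enorm (bt m *: qf m.+1) <= d) ->
  enorm ((A *m krylov m qf - krylov m qf *m trid m al bt) *m v) <=
    c * (m%:R * enorm v) + d * \sum_(j < m | j.+1 == m) `|v j 0|.
Proof.
move=> c0 d0 qf0 hf hd; set E := A *m _ - _.
have Ev : E *m v = \sum_j v j 0 *: col j E.
  apply/matrixP => i k; rewrite ord1 mxE summxE; apply: eq_bigr => j _.
  by rewrite !mxE mulrC.
have Ecol (j : 'I_m) : enorm (col j E) <= c + (if j.+1 == m then d else 0).
  have -> : col j E = A *m qf j.+1 - \sum_(i < m) trid m al bt i j *: qf i.+1.
    apply/matrixP => i k; rewrite ord1 mxE /E mxE [X in _ = X]mxE; congr (_ + _).
      by rewrite !mxE; apply: eq_bigr => l _; rewrite !mxE.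
    rewrite !mxE summxE; congr (- _); apply: eq_bigr => l _.
    by rewrite mulrC [krylov _ _ _ _]mxE [RHS]mxE.
  rewrite krylov_trid_col//.
  have := hf j (ltn_ord j); set f := A *m _ - _ => fc.
  have [jm|jm] := eqVneq j.+1 m.
    have -> : A *m qf j.+1 - (bt j *: qf j + al j *: qf j.+1 +
       (if (j.+1 < m)%N then bt j.+1 *: qf j.+2 else 0)) = f + bt m *: qf m.+1.
      have -> : (j.+1 < m)%N = false by rewrite jm ltnn.
      have -> : bt m *: qf m.+1 = bt j.+1 *: qf j.+2 by rewrite jm.
      by rewrite /f; apply/matrixP => i k; rewrite !mxE; ring.
    by apply: le_trans (ler_enormD _ _) _; apply: lerD => //; apply: hd; rewrite -jm.
  have jm' : (j.+1 < m)%N by rewrite ltn_neqAle jm ltn_ord.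
  rewrite jm' addr0 (_ : _ - _ = f)//.
  by rewrite /f; apply/matrixP => i k; rewrite !mxE; ring.
rewrite Ev; apply: le_trans (ler_enorm_sum _ _) _.
apply: (@le_trans _ _ (\sum_j (c * `|v j 0| + d * (if j.+1 == m then `|v j 0| else 0)))).
  apply: ler_sum => j _; rewrite enormZ mulrC.
  apply: le_trans (ler_wpM2r (normr_ge0 _) (Ecol j)) _.
  by rewrite mulrDl lerD2l; case: ifP; rewrite ?mul0r ?mulr0.
rewrite big_split /= -!mulr_sumr -big_mkcond /= lerD2r ler_wpM2l//.
exact: sum_abs_le_enorm.
Qed.

(** A tridiagonal matrix extends the support by at most one index per product. Thus the last
    coordinate of T^j e_1 is zero for j < m - 1. *)
Lemma iter_trid_low m al bt (i0 : 'I_m) j (i : 'I_m) : i0 = 0%N :> nat -> (j < i)%N ->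
  iter j (mulmx (trid m al bt)) (delta_mx i0 0 : 'cV[R]_m) i 0 = 0.
Proof.
move=> i00; elim: j i => [|j IH] i ji.
  rewrite /= mxE (_ : i == i0 = false)//; apply/eqP => ii; move: ji.
  by rewrite ii i00.
rewrite iterS mxE big1// => l _; have [lj|lj] := ltnP j l; first by rewrite IH// mulr0.
have [sym /(_ l i)] := trid_symtridiag m al bt; rewrite -{1}sym mxE => -> //.
  by rewrite mul0r.
exact: leq_ltn_trans ji.
Qed.

(** Cauchy-Schwarz on each row, restricted to the indices near i, bounds (T v)_i^2 by c^2 times the
    v_j^2 with j near i. Each j is near at most three rows, whence the factor 3. *)
Lemma enorm_trid m (al bt : nat -> R) (c : R) (v : 'cV[R]_m) : 0 <= c ->
  (forall i, (i < m)%N -> bt i ^+ 2 + al i ^+ 2 + bt i.+1 ^+ 2 <= c ^+ 2) ->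
  enorm (trid m al bt *m v) <= Num.sqrt 3 * c * enorm v.
Proof.
move=> c0 hc; apply: enorm_le_sqr; first by rewrite !mulr_ge0 ?sqrtr_ge0 ?enorm_ge0.
rewrite !exprMn sqr_sqrtr; last lra.
pose near (i j : nat) := [|| i == j, j == i.+1 | i == j.+1].
set T := trid m al bt.
have row2 (i : 'I_m) : \sum_j T i j ^+ 2 <= c ^+ 2.
  apply: (@le_trans _ _ (\sum_(j < m) ((if j == i :> nat then al i ^+ 2 else 0)
    + (if j == i.+1 :> nat then bt i.+1 ^+ 2 else 0)
    + (if i == j.+1 :> nat then bt j.+1 ^+ 2 else 0)))).
    apply: ler_sum => j _; rewrite mxE -val_eqE /= (eq_sym (j : nat) i).
    case: eqVneq => [->|_]; first by rewrite ltn_eqF// !addr0.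
    case: eqVneq => [->|_]; last by case: eqP => _; rewrite !add0r ?expr0n.
    by rewrite ltn_eqF ?add0r ?addr0.
  rewrite !big_split /= (sum_ord_if m i (fun=> al i ^+ 2)) ltn_ord.
  rewrite (sum_ord_if m i.+1 (fun=> bt i.+1 ^+ 2)).
  rewrite (sum_ord_if_pred m i (fun j => bt j.+1 ^+ 2)).
  apply: le_trans (hc i (ltn_ord i)).
  have x1 : (if (i.+1 < m)%N then bt i.+1 ^+ 2 else 0) <= bt i.+1 ^+ 2.
    by case: ifP => _ //; exact: sqr_ge0.
  have x2 : (if (i.-1 < m)%N && (0 < i)%N then bt i.-1.+1 ^+ 2 else 0) <= bt i ^+ 2.
    case: (i : nat) => [|k]; first by rewrite andbF sqr_ge0.
    by rewrite /= andbT; case: ifP => _ //; exact: sqr_ge0.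
  by rewrite addrC addrA lerD// lerD.
have near3 (j : 'I_m) : \sum_(i < m) (near i j)%:R <= 3 :> R.
  apply: (@le_trans _ _ (\sum_(i < m) ((if i == j :> nat then 1 else 0)
    + (if i == j.+1 :> nat then 1 else 0) + (if j == i.+1 :> nat then 1 else 0)))).
    apply: ler_sum => i _; rewrite /near.
    by case: (_ == _); case: (_ == _); case: (_ == _); rewrite /= ?mulr1n ?mulr0n; lra.
  rewrite !big_split /= (sum_ord_if m j (fun=> 1)) (sum_ord_if m j.+1 (fun=> 1)).
  rewrite (sum_ord_if_pred m j (fun=> 1)).
  by do 3 case: ifP => _; lra.
apply: (@le_trans _ _ (\sum_(i < m) (c ^+ 2 * \sum_(j < m) ((near i j)%:R * v j 0 ^+ 2)))).
  apply: ler_sum => i _; rewrite -expr2.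
  pose w : 'cV[R]_m := \col_j ((near i j)%:R * v j 0).
  have -> : (T *m v) i 0 = dotv (row i T)^T w.
    rewrite mxE; apply: eq_bigr => j _; rewrite [w _ _]mxE !mxE /near -val_eqE /=.
    case: eqVneq => [_|_]; first by rewrite mul1r.
    case: eqVneq => [_|_]; first by rewrite mul1r.
    by case: eqVneq => [_|_]; rewrite ?mul1r ?mul0r.
  apply: le_trans (cauchy_schwarz_sqr _ _) _; rewrite ler_pM ?dotvv_ge0//.
    apply: le_trans (row2 i); rewrite le_eqVlt; apply/orP; left; apply/eqP.
    by apply: eq_bigr => j _; rewrite !mxE expr2.
  apply: ler_sum => j _; rewrite !mxE -expr2 exprMn -natrX.
  by case: (near i j); rewrite ?exp1n ?exp0n.
rewrite -mulr_sumr exchange_big /= [3 * _]mulrC -[leRHS]mulrA ler_wpM2l ?sqr_ge0// enorm_sqr mulr_sumr.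
by apply: ler_sum => j _; rewrite -mulr_suml expr2 ler_wpM2r// -expr2 sqr_ge0.
Qed.

Lemma enorm_krylov_col n m (qf : nat -> 'cV[R]_n) (j : 'I_m) : col j (krylov m qf) = qf j.+1.
Proof. by apply/matrixP => i k; rewrite ord1 !mxE. Qed.

End Tridiagonal.

(** * Approximate eigendecompositions *)

Section Eigendecomposition.
Variable R : realType.

Lemma near_orthogonal_unitmx m (V : 'M[R]_m) d : specnorm (V^T *m V - 1%:M) <= d -> d < 1 ->
  V \in unitmx.
Proof.
move=> Vd d1; rewrite -unitmx_tr unitmxE unitfE; apply/negP => /det0P[v v0 vV].
have : V *m v^T = 0 by rewrite -[V]trmxK -trmx_mul vV trmx0.
move=> Vv; have := enorm_mulmx (V^T *m V - 1%:M) v^T.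
rewrite mulmxBl -mulmxA Vv mulmx0 mul1mx sub0r enormN.
have vp : 0 < enorm v^T by rewrite enorm_gt0 trmx_eq0.
rewrite -[leLHS]mul1r ler_pM2r//; lra.
Qed.

Variables (m : nat) (V T : 'M[R]_m) (l : 'rV[R]_m) (d t tau : R).
Hypotheses (d0 : 0 <= d) (d1 : d <= 1 / 100).
Hypothesis Vd : specnorm (V^T *m V - 1%:M) <= d.
Hypothesis Td : specnorm (V *m diag_mx l *m V^T - T) <= d * specnorm T.
Hypotheses (Tt : specnorm T <= t) (tt : 10 / 9 * t <= tau).

Let t0 : 0 <= t. Proof. exact: le_trans (specnorm_ge0 _) Tt. Qed.

Lemma gram_defect v : enorm (V^T *m (V *m v) - v) <= d * enorm v.
Proof.
have := enorm_mulmx (V^T *m V - 1%:M) v; rewrite mulmxBl mul1mx -mulmxA => /le_trans; apply.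
by rewrite ler_wpM2r ?enorm_ge0.
Qed.

Lemma enormV_sqr v : `|enorm (V *m v) ^+ 2 - enorm v ^+ 2| <= d * enorm v ^+ 2.
Proof.
rewrite !enorm_sqr dotv_mulmxl -dotvBr; apply: le_trans (cauchy_schwarz _ _) _.
by rewrite -enorm_sqr expr2 mulrCA ler_wpM2l ?enorm_ge0// gram_defect.
Qed.

Lemma enormV_le v : enorm (V *m v) <= (1 + d) * enorm v.
Proof.
have := d0; have v0 := enorm_ge0 v => d0'; apply: le_of_sqr; first by rewrite mulr_ge0//; lra.
have := enormV_sqr v; rewrite ler_norml => /andP[_ h].
have : 0 <= (d + d ^+ 2) * enorm v ^+ 2 by rewrite mulr_ge0 ?sqr_ge0// addr_ge0// sqr_ge0.
lra.
Qed.

Lemma enormV_ge v : (1 - d) * enorm v <= enorm (V *m v).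
Proof.
have := d0; have d1' := d1; have v0 := enorm_ge0 v => d0'.
apply: le_of_sqr; first exact: enorm_ge0.
have := enormV_sqr v; rewrite ler_norml => /andP[h _].
have : 0 <= (d * (1 - d)) * enorm v ^+ 2 by rewrite mulr_ge0 ?sqr_ge0// mulr_ge0//; lra.
lra.
Qed.

(** V is invertible and nearly isometric: for w = V v the vector V^T w is close to v, whose norm is
    close to that of w. *)
Lemma enormVT_le w : enorm (V^T *m w) <= 12 / 10 * enorm w.
Proof.
have d0' := d0; have d1' := d1.
have Vu : V \in unitmx by apply: near_orthogonal_unitmx Vd _; lra.
pose v := invmx V *m w; have wE : w = V *m v by rewrite /v mulmxA mulmxV// mul1mx.
have h1 := enormV_ge v; have h2 := gram_defect v; have v0 := enorm_ge0 v.
have h3 := ler_enorm_dist (V^T *m (V *m v)) v.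
rewrite -wE in h1 h2 h3 *.
have : d * enorm v <= 1 / 100 * enorm v by rewrite ler_wpM2r.
lra.
Qed.

(** If V^T w is the i-th basis vector, then l_i is the quadratic form of V L V^T at w.
    Near-orthogonality gives ||w|| <= 101/99, and (101/99)^2 * 101/100 < 10/9. *)
Lemma eigenvalue_le i : `|l 0 i| <= tau.
Proof.
have d0' := d0; have d1' := d1; have t0' := t0; have tt' := tt.
have Vu : V \in unitmx by apply: near_orthogonal_unitmx Vd _; lra.
pose w := invmx V^T *m (delta_mx i 0 : 'cV[R]_m).
have Vw : V^T *m w = delta_mx i 0 by rewrite /w mulmxA mulmxV ?unitmx_tr// mul1mx.
pose v := invmx V *m w; have wE : w = V *m v by rewrite /v mulmxA mulmxV// mul1mx.
have v1 : 99 / 100 * enorm v <= 1.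
  have h2 := gram_defect v; have := ler_enorm_dist v (V^T *m (V *m v)).
  rewrite enormBC; rewrite -wE Vw enorm_delta in h2 *; have v0 := enorm_ge0 v.
  have : d * enorm v <= 1 / 100 * enorm v by rewrite ler_wpM2r.
  lra.
have w1 : enorm w <= 101 / 99.
  have := enormV_le v; rewrite -wE; have v0 := enorm_ge0 v.
  have : d * enorm v <= 1 / 100 * enorm v by rewrite ler_wpM2r.
  lra.
have lE : l 0 i = dotv w (V *m diag_mx l *m V^T *m w).
  rewrite -!mulmxA Vw -{1}[V]trmxK -dotv_mulmxl Vw /dotv (bigD1 i)//= mul_diag_mx !mxE !eqxx.
  by rewrite mulr1 mul1r big1 ?addr0// => j ji; rewrite !mxE (negPf ji) mul0r.
set S := V *m diag_mx l *m V^T in lE *.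
have w0 := enorm_ge0 w.
have Sw : enorm (S *m w) <= 101 / 100 * t * enorm w.
  have := ler_enorm_dist (S *m w) (T *m w); rewrite -mulmxBl.
  have := le_trans (enorm_mulmx T w) (ler_wpM2r w0 Tt).
  have : specnorm (S - T) <= 1 / 100 * t.
    by apply: le_trans Td _; rewrite ler_pM// specnorm_ge0.
  move=> h; have := le_trans (enorm_mulmx (S - T) w) (ler_wpM2r w0 h).
  lra.
rewrite lE; apply: le_trans (cauchy_schwarz _ _) _.
have h : enorm w * enorm (S *m w) <= 101 / 99 * (101 / 100 * t * (101 / 99)).
  rewrite ler_pM ?enorm_ge0//; apply: le_trans Sw _; rewrite ler_wpM2l//.
  by rewrite mulr_ge0//; lra.
lra.
Qed.

Lemma enorm_diag_le v : enorm (diag_mx l *m v) <= tau * enorm v.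
Proof.
have tau0 : 0 <= tau by have := t0; have := tt; lra.
rewrite -[leRHS]addr0 -[X in _ <= _ + X](mul0r (enorm v)).
apply: ler_enorm_coord2 => // i; rewrite mul0r addr0 mul_diag_mx mxE normrM.
by rewrite ler_wpM2r// eigenvalue_le.
Qed.

(** Intertwining with P = V and no boundary term: T V - V L = V L (V^T V - I) - (V L V^T - T) V, of
    size O(tau d). The summand 2 d pays for replacing w by V V^T w. *)
Lemma eig_taylor D w : enorm (taylor D T w - V *m taylor D (diag_mx l) (V^T *m w)) <=
  (4 * tau + 2) * d * expR tau * enorm w.
Proof.
have d0' := d0; have d1' := d1; have t0' := t0; have tt' := tt.
have tau0 : 0 <= tau by lra.
have w0 := enorm_ge0 w.
have Ttau u : enorm (T *m u) <= tau * enorm u.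
  by apply: le_trans (enorm_mulmx T u) _; rewrite ler_wpM2r ?enorm_ge0//; have := Tt; lra.
have dw0 : 0 <= d * enorm w by rewrite mulr_ge0.
pose v := V^T *m w; have v12 : enorm v <= 12 / 10 * enorm w by exact: enormVT_le.
have resid j : enorm ((T *m V - V *m diag_mx l) *m iter j (mulmx (diag_mx l)) v) <=
    tau ^+ j * (4 * tau * d * enorm w + 0 * (0 <= j.+1)%N%:R).
  have it := enorm_iter v j tau0 enorm_diag_le; set u := iter _ _ _ in it *.
  have u0 := enorm_ge0 u.
  have -> : (T *m V - V *m diag_mx l) *m u = V *m (diag_mx l *m (V^T *m (V *m u) - u))
      - (V *m diag_mx l *m V^T - T) *m (V *m u).
    rewrite !mulmxBl !mulmxBr !mulmxA.
    by apply/matrixP => i k; rewrite [LHS]mxE !mxE; ring.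
  apply: le_trans (ler_enormB _ _) _.
  have k1 := enormV_le (diag_mx l *m (V^T *m (V *m u) - u)).
  have k2 := le_trans (enorm_diag_le _) (ler_wpM2l tau0 (gram_defect u)).
  have k3 := enormV_le u.
  have k4 := le_trans (enorm_mulmx (V *m diag_mx l *m V^T - T) (V *m u))
    (ler_wpM2r (enorm_ge0 _) Td).
  have k5 : d * specnorm T * enorm (V *m u) <= d * tau * (101 / 100 * enorm u).
    rewrite ler_pM ?mulr_ge0 ?specnorm_ge0 ?enorm_ge0//.
      by rewrite ler_wpM2l//; have := Tt; lra.
    by apply: le_trans k3 _; rewrite ler_wpM2r//; lra.
  have k6 : (1 + d) * enorm (diag_mx l *m (V^T *m (V *m u) - u)) <=
      101 / 100 * (tau * (d * enorm u)).
    by rewrite ler_pM ?enorm_ge0//; lra.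
  have k7 : tau * d * enorm u <= tau * d * (tau ^+ j * (12 / 10 * enorm w)).
    rewrite ler_wpM2l ?mulr_ge0//; apply: le_trans it _.
    by rewrite ler_wpM2l ?exprn_ge0.
  have k8 : 0 <= tau ^+ j * (tau * (d * enorm w)) by rewrite !mulr_ge0// exprn_ge0.
  rewrite mul0r addr0; lra.
have kap0 : 0 <= 4 * tau * d * enorm w by rewrite -mulrA mulr_ge0//; lra.
have int := taylor_intertwine tau0 kap0 (lexx 0) Ttau resid D.
have Vu : V \in unitmx by apply: near_orthogonal_unitmx Vd _; lra.
(* Writing w = V z reduces w - V V^T w to the defect of V^T V at z, the only one controlled
   directly. *)
have defect : enorm (w - V *m v) <= 2 * d * enorm w.
  pose z := invmx V *m w; have wE : w = V *m z by rewrite /z mulmxA mulmxV// mul1mx.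
  rewrite /v {1 2}wE -mulmxBr; apply: le_trans (enormV_le _) _; rewrite enormBC.
  have z1 := enormV_ge z; rewrite -wE in z1.
  have z0 := enorm_ge0 z.
  have z2 : enorm z <= 12 / 10 * enorm w.
    have : d * enorm z <= 1 / 100 * enorm z by rewrite ler_wpM2r.
    lra.
  have g := gram_defect z.
  have g2 : (1 + d) * enorm (V^T *m (V *m z) - z) <= 101 / 100 * (d * (12 / 10 * enorm w)).
    rewrite ler_pM ?enorm_ge0//; [lra|lra|].
    by apply: le_trans g _; rewrite ler_wpM2l.
  by apply: le_trans g2 _; lra.
have := enorm_taylor D (w - V *m v) tau0 Ttau; rewrite taylorB => h1.
have h2 : expR tau * enorm (w - V *m v) <= expR tau * (2 * d * enorm w).
  by rewrite ler_wpM2l ?expR_ge0.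
have := ler_enormD (taylor D T w - taylor D T (V *m v))
  (taylor D T (V *m v) - V *m taylor D (diag_mx l) v).
rewrite addrA subrK -/v => /le_trans; apply.
apply: le_trans (lerD (le_trans h1 h2) int) _.
lra.
Qed.

End Eigendecomposition.

(** * Floating-point evaluation of the first column of exp(T) *)

Section MatrixExponentialColumn.
Variables (R : realType) (M : machine R) (e h : R) (tf m : nat).
Hypotheses (e0 : 0 <= e) (req1 : requirement1 M e) (evl : evaluates M expR e tf).
Hypotheses (m0 : (0 < m)%N) (gh : gam e m <= h) (mh : 100 * (m%:R * h) <= 1).

Definition basis0 : 'cV[R]_m := \col_i (i == 0%N :> nat)%:R.

Lemma basis0E (i0 : 'I_m) : i0 = 0%N :> nat -> basis0 = delta_mx i0 0.
Proof. by move=> i00; apply/matrixP => i j; rewrite ord1 !mxE andbT -val_eqE /= i00. Qed.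

Lemma enorm_basis0 : enorm basis0 = 1.
Proof. by rewrite (@basis0E (Ordinal m0))// enorm_delta. Qed.

Variables (T : 'M[R]_m) (d t tau : R).
Hypotheses (d0 : 0 <= d) (d1 : d <= 1 / 100).
Let V := (fl_eig M T d).1.
Let l := (fl_eig M T d).2.
Hypothesis Vd : specnorm (V^T *m V - 1%:M) <= d.
Hypothesis Td : specnorm (V *m diag_mx l *m V^T - T) <= d * specnorm T.
Hypotheses (Tt : specnorm T <= t) (tt : 10 / 9 * t <= tau).

(** Three sources make up 15 m h e^tau: the product with V^T, the scalar exponentials with their
    multiplications, and the product with V. The factor m stems from the Frobenius norm of V, at
    most 2 m. The rest is truncation in the eigenbasis and [eig_taylor]. *)
Lemma fl_mxfun_e1 D : let z := (tmxfun_e1 M expR T d).1 in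
  enorm z <= 4 * expR tau /\
  enorm (z - taylor D T basis0) <= 15 * m%:R * h * expR tau
    + 2 * (expR tau - exp_poly D tau) + (4 * tau + 2) * d * expR tau.
Proof.
move=> z; set H := expR tau.
have H0 : 0 < H := expR_gt0 tau.
have eh : e <= h := le_trans (gam_ge e0 m) gh.
have m1 : 1 <= m%:R :> R by rewrite ler1n.
have h0 : 0 <= h := le_trans e0 eh.
have d0' := d0; have d1' := d1.
have mh0 : 0 <= m%:R * h by rewrite mulr_ge0.
have hmh : h <= m%:R * h by rewrite ler_peMl.
have mh1 : m%:R * h <= 1 / 100 by have := mh; lra.
have h1 : h <= 1 / 100 by lra.
have fV : frob V <= m%:R * 2.
  apply: frob_cols => // j; rewrite colE.
  by apply: le_trans (enormV_le d0 Vd _) _; rewrite enorm_delta; lra.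
have Vle v : enorm (V *m v) <= 101 / 100 * enorm v.
  by apply: le_trans (enormV_le d0 Vd _) _; rewrite ler_wpM2r ?enorm_ge0//; lra.
have lt i : `|l 0 i| <= tau := eigenvalue_le d0 d1 Vd Td Tt tt i.
have lH i : expR (l 0 i) <= H.
  by rewrite ler_expR; apply: le_trans (ler_norm _) (lt i).
pose u0 := V^T *m basis0; pose u := (tmulmx M V^T basis0).1.
have u01 : enorm u0 <= 12 / 10.
  by have := enormVT_le d0 d1 Vd basis0; rewrite enorm_basis0 mulr1.
have du : enorm (u - u0) <= 2 * (m%:R * h).
  apply: le_trans (fl_mulmx e0 req1 V^T basis0) _; rewrite frob_tr enorm_basis0 mulr1.
  have : gam e m * frob V <= h * (m%:R * 2) by rewrite ler_pM ?gam_ge0 ?sqrtr_ge0.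
  lra.
have u2 : enorm u <= 2 by have := ler_enorm_dist u u0; lra.
pose E (w : 'cV[R]_m) : 'cV[R]_m := \col_i (expR (l 0 i) * w i 0).
have Ele w : enorm (E w) <= H * enorm w.
  rewrite -[leRHS]addr0 -[X in _ <= _ + X](mul0r (enorm w)).
  apply: ler_enorm_coord2 => // [|i]; first exact: ltW.
  by rewrite mul0r addr0 [E w i 0]mxE normrM ger0_norm ?expR_ge0// ler_wpM2r.
have EB w1 w2 : E (w1 - w2) = E w1 - E w2.
  by apply/matrixP => i j; rewrite !mxE mulrBr.
pose v : 'cV[R]_m := \col_i fl_mul M (fl_fun M expR (l 0 i)) (u i 0).
have dv : enorm (v - E u) <= 3 * h * H * enorm u.
  rewrite -[leRHS]addr0 -[X in _ <= _ + X](mul0r (enorm u)).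
  apply: ler_enorm_coord2 => // [|i]; first by rewrite !mulr_ge0// ltW.
  rewrite mul0r addr0 mxE [v i 0]mxE [X in _ + X]mxE [E u i 0]mxE; have [[c1 [hc1 ->]] _] := evl (l 0 i).
  case: req1 => _ _ rmul _ _; have [c2 [hc2 ->]] := rmul ((1 + c1) * expR (l 0 i)) (u i 0).
  set X := expR (l 0 i) * u i 0.
  rewrite (_ : _ - _ = (c1 + c2 + c2 * c1) * X); last by rewrite /X; ring.
  rewrite normrM -mulrA; apply: ler_pM => //; last first.
    by rewrite normrM ger0_norm ?expR_ge0// ler_wpM2r.
  have hc3 : `|c2 * c1| <= h by rewrite normrM -[leRHS]mulr1 ler_pM//; lra.
  apply: le_trans (ler_normD _ _) _; have := ler_normD c1 c2; lra.
have dv' : enorm (v - E u) <= 6 * (h * H).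
  apply: le_trans dv _; have : h * H * enorm u <= h * H * 2.
    by rewrite ler_wpM2l// mulr_ge0// ltW.
  lra.
have hH : h * H <= m%:R * h * H by rewrite ler_wpM2r// ltW.
have mhH : m%:R * h * H <= 1 / 100 * H by rewrite ler_wpM2r// ltW.
have hH0 : 0 <= h * H by rewrite mulr_ge0// ltW.
have v3 : enorm v <= 3 * H.
  have Eu : enorm (E u) <= H * 2 by apply: le_trans (Ele u) _; rewrite ler_wpM2l// ltW.
  have := ler_enorm_dist v (E u); lra.
have dvw : enorm (v - E u0) <= 8 * (m%:R * h * H).
  have -> : v - E u0 = (v - E u) + E (u - u0).
    rewrite EB.
    by rewrite addrA subrK.
  apply: le_trans (ler_enormD _ _) _; have := Ele (u - u0).
  have : H * enorm (u - u0) <= H * (2 * (m%:R * h)) by rewrite ler_wpM2l// ltW.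
  lra.
have zE : z = (tmulmx M V v).1 by [].
have dz : enorm (z - V *m v) <= 6 * (m%:R * h * H).
  rewrite zE; apply: le_trans (fl_mulmx e0 req1 V v) _.
  have : gam e m * (frob V * enorm v) <= h * ((m%:R * 2) * (3 * H)).
    by rewrite ler_pM ?gam_ge0 ?mulr_ge0 ?sqrtr_ge0 ?enorm_ge0// ler_pM ?sqrtr_ge0 ?enorm_ge0.
  lra.
split.
  have := ler_enorm_dist z (V *m v); have := Vle v; lra.
have delta0 : 0 <= H - exp_poly D tau.
  have tau0 : 0 <= tau by have := le_trans (specnorm_ge0 T) Tt; have := tt; lra.
  by rewrite subr_ge0 exp_poly_le.
have dE : enorm (E u0 - taylor D (diag_mx l) u0) <= (H - exp_poly D tau) * enorm u0.
  rewrite -[leRHS]addr0 -[X in _ <= _ + X](mul0r (enorm u0)).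
  apply: ler_enorm_coord2 => // i; rewrite mul0r addr0 mxE [E u0 i 0]mxE [X in _ + X]mxE taylor_diag.
  by rewrite -mulrBl normrM ler_wpM2r// exp_tail.
have dE' : (H - exp_poly D tau) * enorm u0 <= (H - exp_poly D tau) * (12 / 10).
  by rewrite ler_wpM2l.
have eig := eig_taylor d0 d1 Vd Td Tt tt D basis0.
rewrite enorm_basis0 mulr1 -/u0 in eig.
have -> : z - taylor D T basis0 = (z - V *m v) + V *m (v - E u0)
   + V *m (E u0 - taylor D (diag_mx l) u0)
   - (taylor D T basis0 - V *m taylor D (diag_mx l) u0).
  rewrite !mulmxBr; apply/matrixP => i j; rewrite [LHS]mxE !mxE; ring.
apply: le_trans (ler_enormB _ _) _; rewrite -/H in eig *.
have n1 := ler_enormD (z - V *m v + V *m (v - E u0)) (V *m (E u0 - taylor D (diag_mx l) u0)).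
have n2 := ler_enormD (z - V *m v) (V *m (v - E u0)).
have n3 := Vle (v - E u0); have n4 := Vle (E u0 - taylor D (diag_mx l) u0).
apply: le_trans (lerD (le_trans n1 (lerD n2 (lexx _))) eig) _.
lra.
Qed.

End MatrixExponentialColumn.

(** * Total error of the returned vector *)

Lemma lanczos_error_budget (R : realFieldType) (m k h H X delta d a eps : R) :
  1 <= m -> m <= k -> 0 <= h -> 1 <= H -> 0 <= X -> 0 <= delta -> 0 <= d -> 0 <= a ->
  10 ^+ 9 * (k ^+ 2 * (1 + a) * h) <= eps -> 200 * (k * (1 + a) * d) <= eps ->
  delta * (8 * k + 1) <= 1 / 4 * eps ->
  delta * X + H * (h * X) + 2 * X * (8 * (m * h * H)
    + m * 2 * (15 * m * h * H + 2 * delta + (4 * (2 * a) + 2) * d * H)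
    + (600 * h * a * m * H + 1 / 4 * (eps * H))) + h * ((2 * X) * (9 * (m * H)))
  <= X * (eps * H).
Proof.
move=> m1 mk h0 H1 X0 del0 d0 a0 hh dh delb.
have m0 : 0 <= m by lra.
have k0 : 0 <= k by lra.
have mm : m * m <= k * k by exact: ler_pM.
have m_mm : m <= m * m by rewrite ler_peMl.
(* The square of k appears because m enters twice, through the Frobenius norms of Q and of the
   computed eigenvector matrix. *)
set G := k ^+ 2 * (1 + a) * h in hh.
have GE : G = k * k * h + k * k * a * h by rewrite /G; ring.
have ah0 : 0 <= a * h by exact: mulr_ge0.
have g1 : m * m * h <= k * k * h by rewrite ler_wpM2r.
have g2 : m * m * (a * h) <= k * k * (a * h) by rewrite ler_wpM2r.
have g3 : m * h <= m * m * h by rewrite ler_wpM2r.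
have g4 : m * (a * h) <= m * m * (a * h) by rewrite ler_wpM2r.
have g5 : h <= m * h by rewrite ler_peMl.
have g6 : 0 <= m * (a * h) by rewrite mulr_ge0.
have g7 : (1 + a) * d * m <= (1 + a) * d * k by rewrite ler_wpM2l// mulr_ge0//; lra.
have g8 : delta * m <= delta * k by rewrite ler_wpM2l.
have g9 : 0 <= m * d by rewrite mulr_ge0.
have eps0 : 0 <= eps by have := mulr_ge0 del0 k0; lra.
have epsH : eps <= eps * H by rewrite ler_peMr.
set Z := h + 16 * (m * h) + 60 * (m * m * h) + (32 * a + 8) * (m * d)
  + 1200 * (m * (a * h)) + 1 / 2 * eps + 18 * (m * h).
have ZE : Z <= 7 / 10 * eps by rewrite /Z; lra.
have HZ : H * Z <= H * (7 / 10 * eps) by rewrite ler_wpM2l//; lra.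
have -> : delta * X + H * (h * X) + 2 * X * (8 * (m * h * H)
    + m * 2 * (15 * m * h * H + 2 * delta + (4 * (2 * a) + 2) * d * H)
    + (600 * h * a * m * H + 1 / 4 * (eps * H))) + h * ((2 * X) * (9 * (m * H)))
  = X * (delta * (8 * m + 1) + H * Z) by rewrite /Z; field.
rewrite ler_wpM2l//; lra.
Qed.

Lemma specnorm_trid (R : realType) n (A : 'M[R]_n) m al bt :
  (forall i, (i < m)%N -> row_bound A (bt i) (al i) (bt i.+1)) ->
  specnorm (trid m al bt) <= 9 / 5 * specnorm A.
Proof.
set a := specnorm A; have a0 : 0 <= a := specnorm_ge0 A.
move=> rb; apply: specnorm_le => [|v]; first by rewrite mulr_ge0//; lra.
have -> : 9 / 5 * a = Num.sqrt 3 * (Num.sqrt (27 / 25) * a).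
  rewrite mulrA -sqrtrM; last lra.
  have -> : 3 * (27 / 25) = (9 / 5) ^+ 2 :> R by rewrite expr2; lra.
  by rewrite sqrtr_sqr ger0_norm//; lra.
apply: enorm_trid => [|i im]; first by rewrite mulr_ge0 ?sqrtr_ge0.
rewrite exprMn sqr_sqrtr; last lra.
exact: rb.
Qed.

(** All hypotheses on the precision are smallness conditions on [h], [d] and the Chernoff tail, so
    that the choice of absolute constants is deferred. [h] dominates every rounding error, [d] is
    the accuracy of the eigensolver. *)
Lemma lanczos_error (R : realType) (M : machine R) (e h d eps : R) (tf n k : nat)
    (A : 'M[R]_n) (x : 'cV[R]_n) : let a := specnorm A in
  0 <= e -> requirement1 M e -> requirement2 M A e -> evaluates M expR e tf ->
  A^T = A -> x != 0 -> 0 < eps -> eps <= 1 -> 0 <= d ->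
  gam e n <= h -> gam e k <= h -> 2 * n%:R `^ (3 / 2) * e <= h -> (0 < k)%N ->
  10 ^+ 9 * (k%:R ^+ 2 * (1 + a) * h) <= eps ->
  200 * (k%:R * (1 + a) * d) <= eps ->
  16 * expR (1 - k%:R + expR 1 * (2 * a)) <= eps ->
  (forall m (T : 'M[R]_m), (0 < m)%N -> (m <= k)%N -> symtridiag T ->
    let V := (fl_eig M T d).1 in let L := diag_mx (fl_eig M T d).2 in
    specnorm (V *m L *m V^T - T) <= d * specnorm T /\ specnorm (V^T *m V - 1%:M) <= d) ->
  enorm (mxfun expR A *m x - (lanczos M A k x expR d).1) <= eps * expR (2 * a) * enorm x.
Proof.
move=> a e0 req1 req2 evl Asym x0 eps0 eps1 d0 ghn ghk mvh k0 hh dh tail eig.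
have a0 : 0 <= a := specnorm_ge0 A.
have k1 : 1 <= k%:R :> R by rewrite ler1n.
have eh : e <= h := le_trans (gam_ge e0 n) ghn.
have h0 : 0 <= h := le_trans e0 eh.
have kk : k%:R <= k%:R ^+ 2 :> R by rewrite expr2 ler_peMl.
have k2h0 : 0 <= k%:R ^+ 2 * h by rewrite mulr_ge0// sqr_ge0.
have ak2h0 : 0 <= a * (k%:R ^+ 2 * h) by rewrite mulr_ge0.
have hh' : 10 ^+ 9 * (k%:R ^+ 2 * h) <= eps by clear -hh ak2h0; lra.
have kh : k%:R * h <= k%:R ^+ 2 * h by rewrite ler_wpM2r.
have h_kh : h <= k%:R * h by rewrite ler_peMl.
have h5 : 10 ^+ 5 * h <= 1 by clear -hh' kh h_kh h0 eps1; lra.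
have kd0 : 0 <= k%:R * d by rewrite mulr_ge0.
have akd0 : 0 <= a * (k%:R * d) by rewrite mulr_ge0.
have d_kd : d <= k%:R * d by rewrite ler_peMl.
have d1 : d <= 1 / 100 by clear -dh akd0 kd0 d_kd eps1; lra.
have X0 : 0 < enorm x by rewrite enorm_gt0.
set X := enorm x in X0 *; have X0' := ltW X0.
have gn1 : gam e n <= 1 by clear -ghn h5 h0; lra.
have [nxe nxX] := fl_norm e0 req1 x gn1; rewrite -/X in nxX.
pose nx := (tnorm M x).1; rewrite -/nx in nxe nxX.
have hX : h * X <= 1 / 10 * X by rewrite ler_wpM2r//; clear -h5 h0; lra.
have gX : 3 * gam e n * X <= 3 * h * X by rewrite ler_wpM2r// ler_wpM2l.
have [nx0 nx2] : 0 < nx /\ nx <= 2 * X by clear -nxX hX gX X0; move: nxX; rewrite ler_norml; lra.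
pose q1 := (tdivscale M x nx).1.
have nxN : nx != 0 by rewrite gt_eqF.
have dq1 : enorm (nx *: q1 - x) <= e * X := fl_divscale e0 req1 x nxN.
have uq1 : almost_unit h q1.
  apply: (almost_unit_enorm e0 ghn h5).
  apply: le_trans (fl_normalize e0 _ nxN nxX _) _; [by clear -ghn h5; lra| |by clear -ghn; lra].
  by apply: le_trans dq1 _; rewrite ler_wpM2r// gam_ge.
have eta0 : 0 <= 600 * h * a by have := mulr_ge0 h0 a0; clear; lra.
have inv0 : lanczos_inv h A (2250 * (600 * h) * a ^+ 2 * 0%:R) 0 q1 0.
  split; rewrite ?enorm0//; [|by left|].
    by rewrite lexx /= mulr_ge0.
  by rewrite mulr0 !mul0r expr0n subrr normr0; split; [exact: eta0|exact: lexx].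
have budget : (4500 * (0 + k)%:R + 2600) * (600 * h) <= 2 / 25 by rewrite add0n; clear -hh' kh h_kh eps1 h0; lra.
have [qf [al [bt]]] := lanczos_loopP e0 req1 req2 Asym ghn mvh h5 budget inv0.
set s := (lanczos_loop M A k 0 q1 0).1 => -[qf0 qf1 bt0 [sk s0 sE] hs].
have {}s0 := s0 k0.
have TE : lanczos_T s = trid (size s) al bt.
  by apply: (lanczos_T_trid (qf := qf)) => i /hs[].
have QE : lanczos_Q s = krylov (size s) qf.
  by apply: (lanczos_Q_krylov (al := al) (bt := bt)) => i /hs[].
pose m := size s; pose T := trid m al bt; pose Q := krylov m qf.
have mk : m%:R <= k%:R :> R by rewrite ler_nat.
have m1 : 1 <= m%:R :> R by rewrite ler1n.
have gm : gam e m <= h by apply: le_trans ghk; apply: le_gam.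
have Tt : specnorm T <= 9 / 5 * a by apply: specnorm_trid => i /hs[_ []].
pose tau := 2 * a; have tau0 : 0 <= tau by rewrite mulr_ge0.
have tt : 10 / 9 * (9 / 5 * a) <= tau by rewrite /tau; clear; lra.
have [Td Vd] := eig _ _ s0 sk (trid_symtridiag (size s) al bt).
pose H := expR tau; have H0 : 0 < H := expR_gt0 tau; have H0' := ltW H0.
have H1 : 1 + tau <= H := expR_ge1Dx tau.
have mmh : m%:R * h <= k%:R * h by rewrite ler_wpM2r.
have mh : 100 * (m%:R * h) <= 1 by clear -mmh kh hh' eps1 k2h0; lra.
(* The truncation error is multiplied by at most 8 k + 1 on its way to the result, hence this
   denominator. *)
have [D hD] : exists D, H - exp_poly D tau <= eps / (4 * (8 * k%:R + 1)).
  by apply: exp_tail_small; rewrite divr_gt0//; clear -k1; lra.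
set delta := H - exp_poly D tau in hD.
have del0 : 0 <= delta by rewrite subr_ge0 exp_poly_le.
have [] := fl_mxfun_e1 e0 req1 evl s0 gm mh d0 d1 Vd Td Tt tt D.
rewrite -/m -/T -/H -/delta; set z := (tmxfun_e1 M expR T d).1 => z4 dz.
pose y := (tmulmx M Q z).1.
have -> : (lanczos M A k x expR d).1 = (tscale M nx y).1.
  by rewrite /y /z /Q /T /m -TE -QE.
have dy0 : enorm (y - Q *m z) <= gam e m * (frob Q * enorm z) := fl_mulmx e0 req1 Q z.
have F40 := fl_scale e0 req1 y nx.
set out := (tscale M nx y).1 in F40 *.
clearbody out; clearbody y; clearbody z; clear TE QE.
clearbody s; clearbody q1; clearbody nx.
have colQ j : enorm (col j Q) <= 2 by rewrite enorm_krylov_col; have [_ []] := hs j (ltn_ord j).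
have fQ : frob Q <= m%:R * 2 by apply: frob_cols.
have Qle v : enorm (Q *m v) <= m%:R * 2 * enorm v.
  by apply: le_trans (enorm_mulmx_frob Q v) _; rewrite ler_wpM2r ?enorm_ge0.
have frQ0 : 0 <= frob Q by exact: sqrtr_ge0.
have z0 := enorm_ge0 z; have y0 := enorm_ge0 y; have gm0 := gam_ge0 e0 m.
have dy : enorm (y - Q *m z) <= 8 * (m%:R * h * H).
  apply: le_trans dy0 _.
  have t : gam e m * (frob Q * enorm z) <= h * ((m%:R * 2) * (4 * H)).
    by rewrite ler_pM ?mulr_ge0// ler_pM.
  by apply: le_trans t _; clear; lra.
have Qz : enorm (Q *m z) <= 8 * (m%:R * H).
  apply: le_trans (Qle z) _; apply: (@le_trans _ _ (m%:R * 2 * (4 * H))).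
    by rewrite ler_wpM2l// mulr_ge0.
  by clear; lra.
have mH0 : 0 <= m%:R * H by rewrite mulr_ge0// ltW.
have hmH : h * (m%:R * H) <= 1 / 100 * (m%:R * H) by rewrite ler_wpM2r//; clear -h5 h0; lra.
have y9 : enorm y <= 9 * (m%:R * H) by have := ler_enorm_dist y (Q *m z); clear -dy Qz hmH mH0; lra.
pose i0 : 'I_m := Ordinal s0.
have b0E : basis0 R m = delta_mx i0 0 by exact: basis0E.
have Qe1 : Q *m basis0 R m = q1.
  by rewrite b0E -colE enorm_krylov_col qf1.
have Ale w : enorm (A *m w) <= tau * enorm w.
  by apply: le_trans (enorm_mulmx A w) _; rewrite ler_wpM2r ?enorm_ge0// /tau -/a; clear -a0; lra.
have Tle w : enorm (T *m w) <= tau * enorm w.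
  by apply: le_trans (enorm_mulmx T w) _; rewrite ler_wpM2r ?enorm_ge0//; clear -Tt tt a0; lra.
have bm2 : 0 <= bt m <= 2 * a.
  have mm : (m.-1 < size s)%N by rewrite prednK.
  have [_ [rb bp _ _ _]] := hs _ mm; rewrite prednK// in rb bp; rewrite bp /=.
  apply: le_of_sqr; first by rewrite mulr_ge0.
  move: rb; rewrite /row_bound -/a; have := sqr_ge0 (bt m.-1); have := sqr_ge0 (al m.-1).
  by have := sqr_ge0 a; clear; lra.
have qm2 : enorm (qf m.+1) <= 2.
  have mm : (m.-1 < size s)%N by rewrite prednK.
  by have [_ [_ _ _]] := hs _ mm; rewrite prednK.
pose c := 600 * h * a; have c0 : 0 <= c by exact: eta0.
pose b := 2 * bt m; have b0 : 0 <= b by rewrite /b; clear -bm2; lra.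
have resid j : enorm ((A *m Q - Q *m T) *m iter j (mulmx T) (basis0 R m)) <=
    tau ^+ j * (c * m%:R + b * (m <= j.+1)%N%:R).
  have it := enorm_iter (basis0 R m) j tau0 Tle; rewrite enorm_basis0// mulr1 in it.
  apply: le_trans (krylov_residual (c := c) (d := b) _ c0 b0 qf0 _ _) _.
  - by move=> i im; have [_ []] := hs i im.
  - move=> _; rewrite enormZ ger0_norm; last by case/andP: bm2.
    by rewrite /b mulrC ler_wpM2r//; case/andP: bm2.
  have sm : \sum_(j0 < m | j0.+1 == m) `|iter j (mulmx T) (basis0 R m) j0 0|
      <= tau ^+ j * (m <= j.+1)%N%:R.
    have mS : m.-1.+1 = m by rewrite prednK.
    have ml : (m.-1 < m)%N by rewrite mS.
    rewrite (bigD1 (Ordinal ml)) /=; last by rewrite mS.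
    rewrite big1 ?addr0; last first.
      by move=> i /andP[/eqP im]; rewrite -val_eqE /= -eqSS mS im eqxx.
    case: leqP => [_|jm]; first by rewrite mulr1; apply: le_trans (ler_coord_enorm _ _) it.
    by rewrite b0E /T (@iter_trid_low _ m al bt i0) ?normr0 ?mulr0//= -ltnS mS.
  have : c * (m%:R * enorm (iter j (mulmx T) (basis0 R m))) <= c * (m%:R * tau ^+ j).
    by rewrite ler_wpM2l// ler_wpM2l.
  by have := ler_wpM2l b0 sm; clear; lra.
have cm0 : 0 <= c * m%:R by rewrite mulr_ge0.
have := taylor_intertwine tau0 cm0 b0 Ale resid D; rewrite Qe1 -/H.
set E3 := b * expR _ => krylov_err.
(* After an early exit beta_(m+1) = 0 and the boundary term disappears. Otherwise m = k and the tail
   hypothesis applies; its factor 16 together with a <= e^(2 a) absorbs b <= 4 a. *)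
have E3le : E3 <= 1 / 4 * (eps * H).
  have aeps : a * eps <= H * eps by rewrite ler_wpM2r//; [exact: ltW|clear -H1 a0; rewrite /tau in H1; lra].
  case: sE => [sE|bE]; last by rewrite /E3 /b /m bE mulr0 mul0r mulr_ge0// mulr_ge0// ltW.
  rewrite /E3 /m sE; have := tail; rewrite -/tau => tl.
  have : b * expR (1 - k%:R + expR 1 * tau) <= (4 * a) * (1 / 16 * eps).
    by rewrite ler_pM ?expR_ge0//; [rewrite /b; clear -bm2; lra | clear -tl; lra].
  by clear -aeps; lra.
have yerr : enorm (y - taylor D A q1) <= 8 * (m%:R * h * H)
    + m%:R * 2 * (15 * m%:R * h * H + 2 * delta + (4 * tau + 2) * d * H)
    + (c * m%:R * H + 1 / 4 * (eps * H)).
  have -> : y - taylor D A q1 = (y - Q *m z) + Q *m (z - taylor D T (basis0 R m))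
      - (taylor D A q1 - Q *m taylor D T (basis0 R m)).
    rewrite mulmxBr; move: (Q *m z) (Q *m taylor D T _) (taylor D A q1) => w1 w2 w3.
    by apply/matrixP => i j; rewrite [RHS]mxE !mxE; ring.
  apply: le_trans (ler_enormB _ _) _; apply: lerD; last by apply: le_trans krylov_err _; rewrite lerD2l.
  apply: le_trans (ler_enormD _ _) _; apply: lerD => //.
  by apply: le_trans (Qle _) _; rewrite ler_wpM2l// mulr_ge0.
have F1 : enorm (mxfun expR A *m x - taylor D A x) <= delta * X.
  by apply: mxfun_exp_taylor => //; rewrite /tau -/a; clear -a0; lra.
have F2 : enorm (taylor D A (x - nx *: q1)) <= H * (h * X).
  apply: le_trans (enorm_taylor D _ tau0 Ale) _; rewrite ler_wpM2l//.
  by rewrite enormBC; apply: le_trans dq1 _; rewrite ler_wpM2r.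
have F3 : enorm (nx *: (taylor D A q1 - y)) <= 2 * X * enorm (y - taylor D A q1).
  by rewrite enormZ gtr0_norm// enormBC ler_wpM2r ?enorm_ge0.
have F4 : enorm (out - nx *: y) <= h * ((2 * X) * (9 * (m%:R * H))).
  apply: le_trans F40 _; rewrite (gtr0_norm nx0).
  by apply: ler_pM => //; [rewrite mulr_ge0// ltW | apply: ler_pM => //; exact: ltW].
(* The four parts are truncation of exp(A), normalisation of x, the error of the computed y for the
   start vector q_1, and the final scaling. *)
rewrite (_ : _ - out = (mxfun expR A *m x - taylor D A x) + taylor D A (x - nx *: q1)
    + nx *: (taylor D A q1 - y) - (out - nx *: y)); last first.
  rewrite taylorB taylorZ; move: (mxfun _ _ *m x) (taylor D A x) (taylor D A q1).
  by move=> w1 w2 w3; apply/matrixP => i j; rewrite [LHS]mxE [RHS]mxE !mxE; ring.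
apply: le_trans (ler_enormB _ _) _.
apply: le_trans (lerD (le_trans (ler_enormD _ _) (lerD (ler_enormD _ _) (lexx _))) (lexx _)) _.
apply: le_trans (lerD (lerD (lerD F1 F2) F3) F4) _.
rewrite (mulrC (eps * _)).
have F5 : 2 * X * enorm (y - taylor D A q1) <= 2 * X * (8 * (m%:R * h * H)
    + m%:R * 2 * (15 * m%:R * h * H + 2 * delta + (4 * tau + 2) * d * H)
    + (c * m%:R * H + 1 / 4 * (eps * H))) by rewrite ler_wpM2l// mulr_ge0.
apply: le_trans (lerD (lerD (lexx _) F5) (lexx _)) _.
have delb : delta * (8 * k%:R + 1) <= 1 / 4 * eps.
  have p0 : 0 < 4 * (8 * k%:R + 1) :> R by clear -k1; lra.
  by move: hD; rewrite ler_pdivlMr//; clear; lra.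
by apply: lanczos_error_budget delb => //; clear -H1 tau0; lra.
Qed.

(** * Running time *)

Lemma time_budget n k m mv tf t1 tc te : (0 < n)%N -> (0 < m)%N -> (m <= k)%N ->
  (t1 <= k * (mv + n * 14 + 2))%N -> (tc <= m * (tf + 2))%N ->
  (n * 3 + 1 + (n * 2 + (t1 + (te + (m * (m * 3).+1 + (tc + m * (m * 3).+1))
     + (n * (m * 3).+1 + n * 2)))) <= k * mv + 28 * (n * k) + (10 + tf) * k ^ 2 + te)%N.
Proof.
move=> n0 m0 mk lt tcle; have k0 := leq_trans m0 mk.
have h1 : (m * m <= k ^ 2)%N by rewrite expnS expn1 leq_mul.
have h2 : (n * m <= n * k)%N by rewrite leq_mul2l mk orbT.
have h3 : (n <= n * k)%N by rewrite leq_pmulr.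
have h4 : (k <= n * k)%N by rewrite leq_pmull.
have h5 : (m <= m * m)%N by rewrite leq_pmulr.
have h6 : (m * tf <= k ^ 2 * tf)%N by rewrite leq_mul2r (leq_trans h5 h1) orbT.
lia.
Qed.

Section RunningTime.
Variables (R : realType) (M : machine R).

Lemma tfold_time (I S : Type) (F : S -> I -> timed S) s0 r c :
  (forall s i, (F s i).2 = c) -> (tfold F s0 r).2 = (size r * c.+1)%N.
Proof.
move=> hF; rewrite /tfold; elim/last_ind: r => [|r i IH] //=.
by rewrite foldl_rcons size_rcons /= IH hF mulSnr.
Qed.

Lemma tdot_time n (u v : 'cV[R]_n) : (tdot M u v).2 = (n * 3)%N.
Proof. by rewrite /tdot (@tfold_time _ _ _ _ _ 2) ?size_enum_ord. Qed.

Lemma tnorm_time n (u : 'cV[R]_n) : (tnorm M u).2 = (n * 3 + 1)%N.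
Proof. by rewrite /tnorm /= tdot_time. Qed.

Lemma tsubscale_time n (u v : 'cV[R]_n) b : (tsubscale M u b v).2 = (n * 3)%N.
Proof. by rewrite /tsubscale /tcol /= sum_nat_const card_ord. Qed.

Lemma tscale_time n (u : 'cV[R]_n) b : (tscale M b u).2 = (n * 2)%N.
Proof. by rewrite /tscale /tcol /= sum_nat_const card_ord. Qed.

Lemma tdivscale_time n (u : 'cV[R]_n) b : (tdivscale M u b).2 = (n * 2)%N.
Proof. by rewrite /tdivscale /tcol /= sum_nat_const card_ord. Qed.

Lemma tmulmx_time p m (P : 'M[R]_(p, m)) u : (tmulmx M P u).2 = (p * (m * 3).+1)%N.
Proof.
rewrite /tmulmx /tcol /= (eq_bigr (fun=> (m * 3).+1)) => [|i _]; last by rewrite tdot_time.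
by rewrite sum_nat_const card_ord.
Qed.

(** Per iteration, two vector updates, an inner product and a norm cost 3 n each and the division 2
    n, in total 14 n; the 2 pays for the square root and the zero test. *)
Lemma lanczos_loop_time n (A : 'M[R]_n) k qp q b :
  ((lanczos_loop M A k qp q b).2 <= k * (time_mv M A + n * 14 + 2))%N.
Proof.
elim: k qp q b => [|k IH] qp q b //.
set w1 := step_w1 M A q qp b; set al := step_alpha M A q qp b.
set w2 := step_w2 M A q qp b; set b' := step_beta M A q qp b.
have -> : (lanczos_loop M A k.+1 qp q b).2 =
  (time_mv M A + ((tsubscale M (fl_mv M A q) b qp).2 + ((tdot M w1 q).2 +
    ((tsubscale M w1 al q).2 + ((tnorm M w2).2 + (1 +
    (if b' == 0%R then tret [:: (al, b', q)]
     else let* q' := tdivscale M w2 b' in let* s := lanczos_loop M A k q q' b' in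
       tret ((al, b', q) :: s)).2))))))%N by [].
rewrite !tsubscale_time tdot_time tnorm_time; case: ifP => _; first by rewrite /=; lia.
have := IH q (tdivscale M w2 b').1 b'.
rewrite [X in (1 + X)%N](_ : _ = ((tdivscale M w2 b').2
  + ((lanczos_loop M A k q (tdivscale M w2 b').1 b').2 + 0))%N)//.
rewrite tdivscale_time; lia.
Qed.

Lemma size_lanczos_loop n (A : 'M[R]_n) k qp q b :
  (size (lanczos_loop M A k qp q b).1 <= k)%N.
Proof.
elim: k qp q b => [|k IH] qp q b //; rewrite lanczos_loopS /= ltnS.
by case: ifP.
Qed.

(** The cost of the eigensolver stays symbolic, since it depends on the matrix produced, whose size
    may be less than k. *)
Lemma lanczos_time n (A : 'M[R]_n) k x d tf e : (0 < n)%N -> (0 < k)%N ->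
  evaluates M expR e tf ->
  exists2 s : seq (R * R * 'cV[R]_n), (0 < size s <= k)%N &
  ((lanczos M A k x expR d).2 <= k * time_mv M A + 28 * (n * k) + (10 + tf) * k ^ 2
     + time_eig M (lanczos_T s) d)%N.
Proof.
move=> n0 k0 evl; set nx := (tnorm M x).1; set q1 := (tdivscale M x nx).1.
pose s := (lanczos_loop M A k 0 q1 0).1.
have sk : (size s <= k)%N := size_lanczos_loop _ _ _ _ _.
have s0 : (0 < size s)%N by rewrite /s; case: (k) k0 => // k' _; rewrite lanczos_loopS.
exists s; first by rewrite s0.
have lt := lanczos_loop_time A k 0 q1 0.
pose m := size s.
pose V := fl_eig M (lanczos_T s) d.
pose u := (tmulmx M V.1^T (\col_i (i == 0%N :> nat)%:R)).1.
pose tc := (\sum_(i < m) (time_fun M expR (V.2 0%R i) + 1).+1)%N.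
have tcle : (tc <= m * (tf + 2))%N.
  rewrite -[X in (_ <= X * _)%N]card_ord -sum_nat_const; apply: leq_sum => i _.
  by have [_] := evl (V.2 0 i); lia.
pose v : 'cV[R]_m := \col_i fl_mul M (fl_fun M expR (V.2 0 i)) (u i 0).
have zt : (tmxfun_e1 M expR (lanczos_T s) d).2 =
    (time_eig M (lanczos_T s) d + (m * (m * 3).+1 + (tc + m * (m * 3).+1)))%N.
  have -> : (tmxfun_e1 M expR (lanczos_T s) d).2 = (time_eig M (lanczos_T s) d +
    ((tmulmx M V.1^T (\col_i (i == 0%N :> nat)%:R)).2 + (tc + (tmulmx M V.1 v).2)))%N by [].
  by rewrite !tmulmx_time.
pose z := (tmxfun_e1 M expR (lanczos_T s) d).1.
have -> : (lanczos M A k x expR d).2 = ((tnorm M x).2 + ((tdivscale M x nx).2 +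
   ((lanczos_loop M A k 0 q1 0).2 + ((tmxfun_e1 M expR (lanczos_T s) d).2 +
   ((tmulmx M (lanczos_Q s) z).2 + (tscale M nx (tmulmx M (lanczos_Q s) z).1).2)))))%N by [].
rewrite tnorm_time tdivscale_time tmulmx_time tscale_time.
rewrite zt; set te := time_eig _ _ _.
exact: time_budget lt tcle.
Qed.

End RunningTime.

(** * Choice of the constants and conclusion *)

Lemma expR1_ge2 (R : realType) : 2 <= expR 1 :> R.
Proof. by have := expR_ge1Dx (1 : R); lra. Qed.

Lemma powR2E (R : realType) (y : R) : 2 `^ y = expR (y * ln 2).
Proof. by rewrite /powR pnatr_eq0. Qed.

Lemma ln2_gt0 (R : realType) : 0 < ln 2 :> R.
Proof. by rewrite ln_gt0//; lra. Qed.

(* Below, [N] dominates n, ||A|| and 1/eps, while [K N] dominates the number of iterations. *)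
Lemma precision_budget (R : realFieldType) (K N G n k a eps e d : R) :
  1 <= K -> 1 <= N -> 1 <= G -> 1 <= n -> n <= N -> 1 <= k -> k <= K * N ->
  0 <= a -> a <= N -> 0 < eps -> 1 <= eps * N -> 0 <= e -> 0 <= d ->
  d * (400 * K * N ^+ 3) <= 1 -> e * (10 ^+ 11 * G * K ^+ 4 * N ^+ 14) <= 1 ->
  10 ^+ 9 * (k ^+ 2 * (1 + a) * (4 * n ^+ 2 * k * e)) <= eps /\
  200 * (k * (1 + a) * d) <= eps.
Proof.
move=> K1 N1 G1 n1 nN k1 kKN a0 aN eps0 epsN e0 d0 hd he.
have N0 : 0 <= N by lra.
have K0 : 0 <= K by lra.
have aN2 : 1 + a <= 2 * N by lra.
have KN0 : 0 <= K * N by exact: mulr_ge0.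
split.
  have t1 : k ^+ 2 * (1 + a) * (4 * n ^+ 2 * k * e) <=
      (K * N) ^+ 2 * (2 * N) * (4 * N ^+ 2 * (K * N) * e).
    have n0 : 0 <= n by lra.
    have k0 : 0 <= k by lra.
    have n20 := sqr_ge0 n; have k20 := sqr_ge0 k.
    have A1 : k ^+ 2 <= (K * N) ^+ 2 by rewrite lerXn2r.
    have A3 : n ^+ 2 <= N ^+ 2 by rewrite lerXn2r.
    have a10 : 0 <= 1 + a by lra.
    have A4 : k ^+ 2 * (1 + a) <= (K * N) ^+ 2 * (2 * N) by exact: ler_pM.
    have n40 : 0 <= 4 * n ^+ 2 by lra.
    have A5 : 4 * n ^+ 2 <= 4 * N ^+ 2 by lra.
    have A6 : 4 * n ^+ 2 * k <= 4 * N ^+ 2 * (K * N) by exact: ler_pM.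
    have A7 : 4 * n ^+ 2 * k * e <= 4 * N ^+ 2 * (K * N) * e by exact: ler_wpM2r.
    have p1 : 0 <= k ^+ 2 * (1 + a) by exact: mulr_ge0.
    have p2 : 0 <= 4 * n ^+ 2 * k * e by do 2 apply: mulr_ge0 => //.
    exact: ler_pM.
  set Z := 10 ^+ 11 * G * K ^+ 4 * N ^+ 14 in he.
  have t2 : K ^+ 3 * N ^+ 7 <= G * K ^+ 4 * N ^+ 14.
    apply: ler_pM; rewrite ?exprn_ge0//; last by rewrite ler_weXn2l.
    rewrite -[leLHS]mul1r; apply: ler_pM; rewrite ?exprn_ge0//.
    by rewrite ler_weXn2l.
  have t3 : 8 * 10 ^+ 9 * (K ^+ 3 * N ^+ 7) * e <= 1.
    apply: le_trans he; rewrite mulrC /Z ler_wpM2l//.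
    have : 0 <= K ^+ 3 * N ^+ 7 by rewrite mulr_ge0 ?exprn_ge0.
    rewrite -!mulrA; lra.
  have t4 : 8 * (K ^+ 3 * N ^+ 6) * e <= 8 * (K ^+ 3 * N ^+ 7) * e * eps.
    have : 0 <= K ^+ 3 * N ^+ 6 * e by rewrite !mulr_ge0 ?exprn_ge0.
    move=> t; have := ler_wpM2l t epsN; rewrite [N ^+ 7]exprS; lra.
  have t5 := ler_wpM2l (ltW eps0) t3.
  lra.
have t1 : k * (1 + a) * d <= K * N * (2 * N) * d.
  by rewrite ler_wpM2r//; apply: ler_pM => //; lra.
have t2 : 0 <= K * N * N * d by rewrite !mulr_ge0.
have t3 := ler_wpM2l t2 epsN; have t4 := ler_wpM2l (ltW eps0) hd.
lra.
Qed.

(** The lower bound [cmv * n] on the matrix-vector time lets all vector operations be charged to it.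
    [Lm] stands for ln(m / d). *)
Lemma runtime_budget (R : realFieldType) (tge cmv tf c3 n k m mv X te t Lm : R) :
  0 < cmv -> 0 < tge -> 0 <= tf -> cmv * n <= mv -> 0 <= mv -> 0 <= m -> m <= k ->
  0 <= Lm -> Lm <= c3 * X -> 1 <= X ->
  te <= tge * (m ^+ 2 * Lm + m * Lm ^+ 2) ->
  t <= k * mv + 28 * (n * k) + (10 + tf) * k ^+ 2 + te ->
  t <= (1 + 28 / cmv + 10 + tf + tge * c3 + tge * c3 ^+ 2) * (k * mv + k ^+ 2 * X + k * X ^+ 2).
Proof.
move=> cmv0 tge0 tf0 cn mv0 m0 mk Lm0 LmX X1 hte ht.
have k0 : 0 <= k := le_trans m0 mk.
have X0 : 0 <= X by lra.
have c3X : 0 <= c3 * X := le_trans Lm0 LmX.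
have c30 : 0 <= c3 by rewrite -(pmulr_lge0 _ (lt_le_trans ltr01 X1)).
have m2 : m ^+ 2 <= k ^+ 2 by rewrite lerXn2r ?nnegrE.
have L2 : Lm ^+ 2 <= (c3 * X) ^+ 2 by rewrite lerXn2r ?nnegrE.
have te1 : m ^+ 2 * Lm <= k ^+ 2 * (c3 * X) by apply: ler_pM => //; exact: sqr_ge0.
have te2 : m * Lm ^+ 2 <= k * (c3 * X) ^+ 2 by apply: ler_pM => //; exact: sqr_ge0.
have te3 : te <= tge * (k ^+ 2 * (c3 * X) + k * (c3 * X) ^+ 2).
  by apply: le_trans hte _; rewrite ler_pM2l//; lra.
have nE : n <= mv / cmv by rewrite ler_pdivlMr// mulrC.
have nk : n * k <= mv / cmv * k by rewrite ler_wpM2r.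
set S := k * mv + k ^+ 2 * X + k * X ^+ 2.
have p1 : 0 <= k * mv by exact: mulr_ge0.
have p2 : 0 <= k ^+ 2 * X by rewrite mulr_ge0 ?sqr_ge0.
have p3 : 0 <= k * X ^+ 2 by rewrite mulr_ge0 ?sqr_ge0.
have s1 : k * mv <= S by rewrite /S; lra.
have s2 : k ^+ 2 * X <= S by rewrite /S; lra.
have s3 : k * X ^+ 2 <= S by rewrite /S; lra.
have s4 : k ^+ 2 <= S by apply: le_trans s2; rewrite ler_peMr ?sqr_ge0.
have i0 : 0 <= 28 / cmv by rewrite divr_ge0// ltW.
have q1 : 28 * (n * k) <= 28 / cmv * S.
  have := ler_wpM2l i0 s1; have : 28 * (n * k) <= 28 * (mv / cmv * k) by lra.
  have -> : 28 * (mv / cmv * k) = 28 / cmv * (k * mv) by ring.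
  lra.
have q2 : (10 + tf) * k ^+ 2 <= (10 + tf) * S by rewrite ler_wpM2l//; lra.
have q3 : tge * (k ^+ 2 * (c3 * X)) <= tge * c3 * S.
  have : 0 <= tge * c3 by rewrite mulr_ge0// ltW.
  by move=> q; have := ler_wpM2l q s2; lra.
have q4 : tge * (k * (c3 * X) ^+ 2) <= tge * c3 ^+ 2 * S.
  have : 0 <= tge * c3 ^+ 2 by rewrite mulr_ge0 ?sqr_ge0// ltW.
  by move=> q; have := ler_wpM2l q s3; lra.
move: ht te3 s1 q1 q2 q3 q4; clear; lra.
Qed.

(** The claimed time contains B itself, and only its whole sum is read as at least 1. Where B < 1,
    replacing B by 1 costs at most k^2 + k, which is then bounded by a constant. *)
Lemma regime_budget (R : realFieldType) (k mv B Y : R) : 0 <= k -> 0 <= mv -> 0 <= B ->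
  0 <= Y -> (B < 1 -> k ^+ 2 + k <= Y) ->
  k * mv + k ^+ 2 * Num.max 1 B + k * Num.max 1 B ^+ 2 <=
    (1 + Y) * Num.max 1 (mv * k + k ^+ 2 * B + k * B ^+ 2).
Proof.
move=> k0 mv0 B0 Y0 hB; set Z := mv * k + _ + _.
have [Z1 ZZ] : 1 <= Num.max 1 Z /\ Z <= Num.max 1 Z by rewrite !le_max !lexx orbT.
have p : 0 <= Y * (Num.max 1 Z - 1) by rewrite mulr_ge0// subr_ge0.
have p1 : 0 <= k ^+ 2 * B by rewrite mulr_ge0 ?sqr_ge0.
have p2 : 0 <= k * B ^+ 2 by rewrite mulr_ge0 ?sqr_ge0.
have [B1|B1] := leP 1 B.
  by rewrite /Z in ZZ *; lra.
have := hB B1; rewrite /Z in ZZ *; rewrite expr1n; lra.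
Qed.

Lemma lanczos_T_symtridiag (R : realType) n (s : seq (R * R * 'cV[R]_n)) :
  symtridiag (lanczos_T s).
Proof.
rewrite (_ : lanczos_T s = trid (size s) (fun i => (nth (0, 0, 0) s i).1.1)
  (fun i => (nth (0, 0, 0) s i.-1).1.2)); first exact: trid_symtridiag.
by apply/matrixP => i j; rewrite !mxE.
Qed.

Lemma ler_ln_sublinear (R : realType) (y : R) : 0 < y -> ln y <= y.
Proof. by move=> y0; apply: ltW; exact: ln_sublinear. Qed.

Theorem theorem15 (R : realType) (cge tge cmv : R) (tf : nat)
    (cge_gt0 : 0 < cge) (tge_gt0 : 0 < tge) (cmv_gt0 : 0 < cmv) :
  exists2 ck : R, 0 < ck &
  forall Ck : R, ck <= Ck ->
  exists c1 cB Crt : R, [/\ 0 < c1, 0 < cB, 0 < Crt &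
  forall (n : nat) (A : 'M[R]_n) (x : 'cV[R]_n) (eps emach : R) (k : nat)
         (M : machine R),
    let B := ln (Num.max n%:R (specnorm A) / eps) in
    let E := specnorm A + ln (1 / eps) in
    A^T = A -> x != 0 -> 0 < eps -> eps <= 1 ->
    ck * Num.max 1 E <= k%:R -> k%:R <= Ck * Num.max 1 E ->
    0 < emach -> emach <= 2 `^ (- (cB * Num.max 1 B)) ->
    requirement1 M emach -> requirement2 M A emach ->
    evaluates M expR emach tf ->
    gu_eisenstat M emach cge tge ->
    cmv * n%:R <= (time_mv M A)%:R ->
    let out := lanczos M A k x expR (2 `^ (- (c1 * Num.max 1 B))) in
    enorm (mxfun expR A *m x - out.1)
      <= eps * expR (2 * specnorm A) * enorm x /\
    out.2%:R <= Crt * Num.max 1 ((time_mv M A)%:R * k%:R + k%:R ^+ 2 * B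
                                 + k%:R * B ^+ 2)].
Proof.
have e12 := expR1_ge2 R; have l2 := ln2_gt0 R; have l2N : ln 2 != 0 :> R by rewrite gt_eqF.
(* The Chernoff tail needs k >= 5 + 2 e a + ln(1/eps), where 16 <= e^4 is used; the right side is at
   most (6 + 2 e) max(1, E). *)
exists (6 + 2 * expR 1); first by lra.
move=> Ck ckCk.
(* Both a and ln(1/eps) are at most N = e^X, so max(1, E) <= 2 N and k <= K N. *)
pose K := 2 * Ck; have K1 : 1 <= K by rewrite /K; lra.
pose G := Num.max 1 cge; have G1 : 1 <= G by rewrite le_max lexx.
have Gc : cge <= G by rewrite le_max lexx orbT.
have KK1 : 1 <= 400 * K by lra.
have K41 : 1 <= K ^+ 4 by rewrite exprn_ege1.
have GK1 : 1 <= G * K ^+ 4 by rewrite -[leLHS]mulr1 ler_pM//; lra.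
pose P := 10 ^+ 11 * G * K ^+ 4; have P1 : 1 <= P by rewrite /P -mulrA; lra.
pose L1 := ln (400 * K); have L10 : 0 <= L1 by exact: ln_ge0.
pose L2 := ln P; have L20 : 0 <= L2 by exact: ln_ge0.
have L1E : expR L1 = 400 * K by rewrite lnK// posrE; lra.
have L2E : expR L2 = P by rewrite lnK// posrE; lra.
(* Since X >= 1, [c1] yields d <= 1 / (400 K N^3). The exponent in [cB] leaves room for emach P N^14
   <= 1 and for emach P N^4 <= d, the accuracy range of the eigensolver. Division by ln 2 passes to
   powers of 2. *)
pose c1 := (3 + L1) / ln 2; pose cB := (14 + L1 + L2) / ln 2.
(* From ln m <= L1 + X and ln(1/d) = (3 + L1) X one gets ln(m / d) <= c3 X. *)
pose c3 := 4 + 2 * L1.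
(* If B < 1 then X = 1 and N = e, so k <= K e and k^2 + k <= Y. *)
pose Y := 2 * (K * expR 1) ^+ 2.
have Y0 : 0 <= Y by rewrite /Y; have := sqr_ge0 (K * expR 1); lra.
pose c4 := 1 + 28 / cmv + 10 + tf%:R + tge * c3 + tge * c3 ^+ 2.
have c4p : 0 < c4.
  have i0 : 0 <= 28 / cmv by rewrite divr_ge0// ltW.
  have i1 : 0 <= tge * c3 by rewrite mulr_ge0//; [exact: ltW|rewrite /c3; lra].
  have i2 : 0 <= tge * c3 ^+ 2 by rewrite mulr_ge0 ?sqr_ge0//; exact: ltW.
  have i3 : 0 <= tf%:R :> R by [].
  rewrite /c4; lra.
exists c1, cB, (c4 * (1 + Y)); split.
- by rewrite divr_gt0//; lra.
- by rewrite divr_gt0//; lra.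
- by rewrite mulr_gt0//; lra.
move=> n A x eps e k M B E Asym x0 eps0 eps1 ckk kCk e0 eB req1 req2 evl ge cn out.
pose a := specnorm A; have a0 : 0 <= a := specnorm_ge0 A.
pose X := Num.max 1 B; have X1 : 1 <= X by rewrite le_max lexx.
have XB : B <= X by rewrite le_max lexx orbT.
pose N := expR X.
have n0 : (0 < n)%N.
  by case: (n) x x0 {A Asym B E eB req2 cn out X X1 XB N a a0 ckk kCk} => // x; rewrite (flatmx0 x) eqxx.
have n1 : 1 <= n%:R :> R by rewrite ler1n.
have nmax : n%:R <= Num.max n%:R a by rewrite le_max lexx.
have amax : a <= Num.max n%:R a by rewrite le_max lexx orbT.
set mx := Num.max n%:R a in nmax amax.
have mx1 : 1 <= mx := le_trans n1 nmax.
have epsV : 1 <= eps^-1 by rewrite invf_ge1.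
have mxe : mx <= mx / eps by rewrite ler_peMr// (le_trans ler01).
have mxe1 : 1 <= mx / eps := le_trans mx1 mxe.
have B0 : 0 <= B by exact: ln_ge0.
have NB : mx / eps <= N.
  by rewrite -[leLHS](lnK (_ : mx / eps \is Num.pos)) ?ler_expR ?posrE; [exact: XB|lra].
have N1 : 1 <= N := le_trans mxe1 NB.
have nN : n%:R <= N := le_trans nmax (le_trans mxe NB).
have aN : a <= N := le_trans amax (le_trans mxe NB).
have epsV0 : 0 <= eps^-1 by rewrite invr_ge0 ltW.
have eN : eps^-1 <= N by apply: le_trans NB; rewrite ler_peMl.
have epsN : 1 <= eps * N by rewrite -ler_pdivrMl// mulr1.
have lne : 0 <= ln (1 / eps) by rewrite div1r ln_ge0.
have lneN : ln (1 / eps) <= N.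
  by rewrite div1r; apply: le_trans eN; apply: ler_ln_sublinear; rewrite invr_gt0.
have mE1 : 1 <= Num.max 1 E by rewrite le_max lexx.
have mEE : E <= Num.max 1 E by rewrite le_max lexx orbT.
have mEN : Num.max 1 E <= 2 * N by rewrite ge_max; apply/andP; split; rewrite /E -/a; clear -N1 aN lneN; lra.
have kKN : k%:R <= K * N.
  apply: le_trans kCk _; have : Ck * Num.max 1 E <= Ck * (2 * N) by rewrite ler_wpM2l//; clear -K1; rewrite /K in K1; lra.
  by rewrite /K; clear; lra.
have ck6 : (6 + 2 * expR 1) * 1 <= (6 + 2 * expR 1) * Num.max 1 E.
  by rewrite ler_wpM2l//; clear -e12; lra.
have k1 : 1 <= k%:R :> R by clear -ck6 ckk e12; lra.
have k0 : (0 < k)%N by rewrite -(ler_nat R).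
pose d := 2 `^ (- (c1 * X)).
have dE : d = expR (- (3 + L1) * X) by rewrite /d powR2E; congr expR; rewrite /c1; field.
have eE : e <= expR (- (14 + L1 + L2) * X).
  by apply: le_trans eB _; rewrite powR2E -/X ler_expR /cB le_eqVlt; apply/orP; left; apply/eqP; field.
have d0 : 0 < d by rewrite dE expR_gt0.
have L1X : 0 <= L1 * (X - 1) by rewrite mulr_ge0// subr_ge0.
have L2X : 0 <= L2 * (X - 1) by rewrite mulr_ge0// subr_ge0.
have hd : d * (400 * K * N ^+ 3) <= 1.
  rewrite dE -L1E /N -expRM_natl -!expRD -expR0 ler_expR; clear -L1X; lra.
have eP : 0 <= P := le_trans ler01 P1.
have he : e * (P * N ^+ 14) <= 1.
  apply: le_trans (ler_wpM2r _ eE) _; first by rewrite mulr_ge0// exprn_ge0// expR_ge0.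
  rewrite -L2E /N -expRM_natl -!expRD -expR0 ler_expR; clear -L1X L2X L10 X1; nra.
have hed : e * (P * N ^+ 4) <= d.
  apply: le_trans (ler_wpM2r _ eE) _; first by rewrite mulr_ge0// exprn_ge0// expR_ge0.
  rewrite -L2E dE /N -expRM_natl -!expRD ler_expR; clear -L1X L2X L10 X1; lra.
have [hh dh] := precision_budget K1 N1 G1 n1 nN k1 kKN a0 aN eps0 epsN (ltW e0) (ltW d0) hd he.
(* Large enough for [gam e n], [gam e k] and the error 2 n^(3/2) emach of the matrix-vector product
   at once. *)
set h := 4 * n%:R ^+ 2 * k%:R * e in hh.
have nn1 : n%:R <= n%:R ^+ 2 :> R by rewrite expr2 ler_peMl.
have nnk : n%:R ^+ 2 <= n%:R ^+ 2 * k%:R :> R by rewrite ler_peMr// sqr_ge0.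
have knn : k%:R <= n%:R ^+ 2 * k%:R :> R by rewrite ler_peMl// (le_trans n1).
set Q := n%:R ^+ 2 * k%:R : R in nnk knn.
have hE : h = 4 * (Q * e) by rewrite /h /Q; ring.
have Q0 : 0 <= Q by rewrite mulr_ge0// exprn_ge0.
have e0' := ltW e0; have Qe0 : 0 <= Q * e by rewrite mulr_ge0.
have h0 : 0 <= h by rewrite hE; clear -Qe0; lra.
have h1 : h <= 1.
  have t1 : 0 <= (k%:R ^+ 2 * (1 + a) - 1) * h.
    rewrite mulr_ge0// subr_ge0 -[leLHS]mulr1; apply: ler_pM => //; first exact: exprn_ege1.
    by clear -a0; lra.
  by clear -hh t1 eps1 h0; lra.
have gam_h j : (0 < j)%N -> j%:R <= Q -> gam e j <= h.
  move=> j0 jQ; have t : 2 * j.+1%:R * e <= h.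
    have j1 : 1 <= j%:R :> R by rewrite ler1n.
    rewrite -natr1 hE; have : (j%:R + 1) * e <= (Q + Q) * e by rewrite ler_wpM2r//; clear -j1 jQ; lra.
    clear; lra.
  by apply: (le_trans _ t); apply: gam_le => //; exact: (le_trans t h1).
have mvh : 2 * n%:R `^ (3 / 2) * e <= h.
  have t : n%:R `^ (3 / 2) <= n%:R ^+ 2 :> R.
    by rewrite -powR_mulrn//; apply: ler_powR => //; clear; lra.
  have t2 : n%:R `^ (3 / 2) * e <= Q * e by rewrite ler_wpM2r// (le_trans t).
  by rewrite hE; clear -t2 Qe0; lra.
have dsmall : d <= 1 / 200.
  have : 0 <= d * (k%:R * (1 + a) - 1).
    rewrite mulr_ge0 ?(ltW d0)// subr_ge0 -[leLHS]mulr1; apply: ler_pM => //.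
    by clear -a0; lra.
  by clear -dh eps1 d0; lra.
(* Since ln m <= m <= K N, the required lower bound is at most emach times cge (K N)^4, which [hed]
   absorbs. *)
have gu_cond m : (0 < m)%N -> (m <= k)%N -> cge * m%:R ^+ 3 * ln m%:R * e <= d.
  move=> m0 mk; apply: le_trans hed; have mp : 0 < m%:R :> R by rewrite ltr0n.
  rewrite [leRHS]mulrC ler_wpM2r ?(ltW e0)//.
  have mk' : m%:R <= K * N by apply: le_trans kKN; rewrite ler_nat.
  have t1 : m%:R ^+ 3 * ln m%:R <= m%:R ^+ 3 * m%:R :> R.
    by rewrite ler_wpM2l ?exprn_ge0// ler_ln_sublinear.
  have t2 : m%:R ^+ 4 <= (K * N) ^+ 4 by rewrite lerXn2r ?nnegrE//; exact: le_trans (ler0n _ _) mk'.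
  have t3 : cge * (m%:R ^+ 3 * ln m%:R) <= G * (K * N) ^+ 4.
    apply: ler_pM => //; [exact: ltW| by rewrite mulr_ge0 ?exprn_ge0// ln_ge0// ler1n|].
    by apply: le_trans t1 _; rewrite -exprSr.
  have t4 : 0 <= G * (K * N) ^+ 4.
    by rewrite mulr_ge0 ?(le_trans ler01 G1)// exprn_ge0// (le_trans _ kKN).
  rewrite -mulrA; apply: le_trans t3 _; rewrite /P.
  by clear -t4; move: t4; rewrite exprMn; lra.
have eig m (T : 'M[R]_m) : (0 < m)%N -> (m <= k)%N -> symtridiag T ->
    let V := (fl_eig M T d).1 in let L := diag_mx (fl_eig M T d).2 in
    specnorm (V *m L *m V^T - T) <= d * specnorm T /\ specnorm (V^T *m V - 1%:M) <= d.
  move=> m0 mk Ts; have [] := ge m T d m0 Ts (gu_cond m m0 mk) d0; last by [].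
  by clear -dsmall; lra.
have tail : 16 * expR (1 - k%:R + expR 1 * (2 * a)) <= eps.
  have i16 : 16 <= expR 4 :> R.
    have -> : 4 = 4%:R * 1 :> R by rewrite mulr1.
    rewrite expRM_natl (_ : 16 = 2 ^+ 4); last by rewrite -natrX.
    by rewrite lerXn2r// nnegrE ?expR_ge0.
  have epsE : eps = expR (- ln (1 / eps)).
    by rewrite expRN lnK ?posrE ?divr_gt0// div1r invrK.
  rewrite epsE; apply: le_trans (ler_wpM2r (expR_ge0 _) i16) _; rewrite -expRD ler_expR.
  have t1 : expR 1 * E <= expR 1 * Num.max 1 E by rewrite ler_wpM2l ?expR_ge0.
  have t2 : 0 <= expR 1 * ln (1 / eps) by rewrite mulr_ge0 ?expR_ge0.
  have t3 : (5 + 1) * Num.max 1 E >= 5 + E by clear -mEE mE1; lra.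
  by clear -ckk t1 t2 t3 lne a0; move: t1 t3; rewrite /E -/a; lra.
split.
  apply: (@lanczos_error R M e h d eps tf n k A x) => //; try exact: ltW.
    by apply: gam_h => //; exact: le_trans nnk.
  by apply: gam_h.
have [s /andP[s0 sk] tle] := lanczos_time A x d n0 k0 evl.
have d12 : d <= 1 / 2 by clear -dsmall; lra.
have [_ _ tE] := ge _ _ d s0 (lanczos_T_symtridiag s) (gu_cond _ s0 sk) d0 d12.
have m1 : 1 <= (size s)%:R :> R by rewrite ler1n.
have mk : (size s)%:R <= k%:R :> R by rewrite ler_nat.
have mp : 0 < (size s)%:R :> R by rewrite ltr0n.
have Kp : 0 < K by clear -K1; lra.
have lnm : ln (size s)%:R <= ln K + X.
  have Np : 0 < N by exact: expR_gt0.
  have KNp : 0 < K * N by rewrite mulr_gt0.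
  have <- : ln (K * N) = ln K + X by rewrite lnM ?posrE// expRK.
  by rewrite ler_ln ?posrE// (le_trans mk kKN).
have lnK1 : ln K <= L1 by rewrite /L1 ler_ln ?posrE; clear -K1; lra.
have LmE : ln ((size s)%:R / d) = ln (size s)%:R + (3 + L1) * X.
  by rewrite ln_div ?posrE// dE expRK mulNr opprK.
have Lm0 : 0 <= ln ((size s)%:R / d).
  by rewrite LmE addr_ge0 ?ln_ge0// mulr_ge0//; clear -L10 X1; lra.
have LmX : ln ((size s)%:R / d) <= c3 * X.
  rewrite LmE /c3; have h2 := le_trans lnm (lerD lnK1 (lexx X)).
  by clear -h2 L1X X1 L10; lra.
have tleR : out.2%:R <= k%:R * (time_mv M A)%:R + 28 * (n%:R * k%:R)
    + (10 + tf%:R) * k%:R ^+ 2 + (time_eig M (lanczos_T s) d)%:R :> R.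
  apply: le_trans (_ : _ <= (k * time_mv M A + 28 * (n * k) + (10 + tf) * k ^ 2
     + time_eig M (lanczos_T s) d)%N%:R) _; first by rewrite ler_nat.
  by rewrite !(natrD, natrM, natrX).
have run := runtime_budget cmv_gt0 tge_gt0 (ler0n R tf) cn (ler0n R _) (ltW mp) mk Lm0 LmX X1 tE tleR.
apply: le_trans run _; rewrite -/c4 -[leRHS]mulrA ler_wpM2l ?(ltW c4p)//.
apply: regime_budget => // B1.
have XE : X = 1 by rewrite /X max_l// ltW.
have kKe : k%:R <= K * expR 1 by have := kKN; rewrite /N XE.
have Ke1 : 1 <= K * expR 1 by apply: le_trans k1 kKe.
have k2 : k%:R ^+ 2 <= (K * expR 1) ^+ 2 by rewrite lerXn2r ?nnegrE//; exact: le_trans ler01 Ke1.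
have kk : k%:R <= k%:R ^+ 2 :> R by rewrite expr2 ler_peMl.
by rewrite /Y; clear -k2 kk; lra.
Qed.
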